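(* Let $\mathcal{I}$ be a random instance in $F(n,m(n),B,P)$, where one of the clause types of $P$ is $\mathbf{K}_t=(k)$ for some $1\le t\le T$ (with $k\ge 2$ in parts (c),(d) where $r_k^*$ appears). (a) Let $h(n)=O(1)$. (i) If $T=1$ (so $P=P_{(k)}$) and $m(n)=o(n^{1-1/2^k})$, then $\mathcal{I}$ is SAT w.h.p. (ii) If $m(n)=\Theta(n^{1-1/2^k})$, then the probability that $\mathcal{I}$ is SAT is bounded away from $1$; if moreover $T=1$, it is bounded away from both $0$ and $1$. (iii) If $m(n)=\omega(n^{1-1/2^k})$, then $\mathcal{I}$ is UNSAT w.h.p. (b) If $h(n)=o\left(\frac{\ln n}{\ln\ln n}\right)$ and there exist $\theta>0$ and $c>0$ with $m(n)\ge c\, n/\ln^{\theta} n$ for all large $n$, then $\mathcal{I}$ is UNSAT w.h.p. (c) If $h(n)=o(\ln n)$ and $m(n)=\Omega\left(n\cdot e^{-\beta\ln n/h(n)}\right)$ for some $\beta<1/r_k^*$, then $\mathcal{I}$ is UNSAT w.h.p. (d) Let $h(n)=O(\ln n)$ and $T=1$. Then there exists $\varepsilon_0>0$ such that, if $m(n)=\alpha n$ with $\alpha>r_k^*-\varepsilon_0$, then $\mathcal{I}$ is UNSAT w.h.p.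
   Context: Community model. There are $n$ Boolean variables $v_1,\ldots,v_n$, partitioned into $B$ communities of equal size $h$, $n=Bh$, with $\mathcal{C}_i=\{v_j:(i-1)h+1\le j\le ih\}$. A literal is a variable or its negation; a clause is a disjunction of literals on distinct variables; an instance is a conjunction of clauses, SAT if some truth assignment satisfies it and UNSAT otherwise. A clause type is a tuple $\mathbf{K}=(k_1,\ldots,k_\ell)$ of non-increasing positive integers with $\ell\le B$ and each $k_j\le h$; $\Omega_B(n,\mathbf{K})$ is the set of all clauses of length $k_1+\cdots+k_\ell$ such that, for some mutually distinct communities $\mathcal{C}_{i_1},\ldots,\mathcal{C}_{i_\ell}$, exactly $k_j$ of the clause's variables lie in $\mathcal{C}_{i_j}$; $P_{\mathbf{K}}$ is the uniform probability measure on $\Omega_B(n,\mathbf{K})$. The type $(k)$ means all $k$ variables in one community. Given $T\ge1$ mutually distinct clause types $\mathbf{K}_1,\ldots,\mathbf{K}_T$ and fixed probabilities $p_1,\ldots,p_T>0$ summing to $1$, put $P=\sum_t p_tP_{\mathbf{K}_t}$. $F(n,m,B,P)$ is the probability space of instances consisting of $m$ clauses chosen independently, each according to $P$ (each variable negated independently with probability $1/2$ under the uniform measure). Asymptotics are as $n\to\infty$ with $B=B(n)$, $h=h(n)=n/B(n)$, $m=m(n)$; the types and $p_t$ are fixed. W.h.p. means with probability tending to $1$; ''probability bounded away from $1$'' means $\limsup<1$, ''bounded away from $0$'' means $\liminf>0$. $f=\Omega(g)$ means $g=O(f)$; $f=\omega(g)$ means $g=o(f)$. For $k\ge2$, $r_k^*=\inf\{\alpha:$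 a random $k$-SAT instance with $\alpha n$ clauses drawn independently and uniformly from all $\binom nk2^k$ clauses on $k$ distinct variables is UNSAT w.h.p.$\}$.
   Formalization: In (c) it is also assumed that h(n) > β·2^k for all large n; as stated (c) contradicts (a)(i), e.g. T=1, k=2, h=2, β=0.99. The condition is automatic when h(n)→∞, and for k≥3 it follows from known lower bounds on r_k^*. *)

(* Defs.v *)
From HB Require Import structures.
From mathcomp Require Import all_boot all_order all_algebra.
From mathcomp Require Import all_classical all_reals all_analysis.

Set Implicit Arguments.
Unset Strict Implicit.
Unset Printing Implicit Defensive.

Import Order.TTheory GRing.Theory Num.Theory.
Import numFieldNormedType.Exports.

Local Open Scope classical_set_scope.
Local Open Scope ring_scope.

(* A clause on the variables 'I_n: [c v] is [None] if v does not occur in c,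
   [Some true] if the literal v does, [Some false] if its negation does.
   The variables of a clause are thus distinct by construction. *)
Notation clause n := {ffun 'I_n -> option bool}.

Notation instance n m := {ffun 'I_m -> clause n}.

Definition vars (n : nat) (c : clause n) : {set 'I_n} :=
  [set v | c v != None]%SET.

Definition satisfies (n : nat) (a : {ffun 'I_n -> bool}) (c : clause n) : bool :=
  [exists v, c v == Some (a v)].

Definition sat (n m : nat) (I : instance n m) : bool :=
  [exists a : {ffun 'I_n -> bool}, [forall i, satisfies a (I i)]].

Definition unsat (n m : nat) (I : instance n m) : bool := ~~ sat I.

(* Variables and communities are numbered from 0. *)
Definition community (n h i : nat) : {set 'I_n} := [set v : 'I_n | (v %/ h == i)%N]%SET.

Definition is_clause_type (K : seq nat) : bool :=
  [&& K != [::], sorted geq K & all (leq 1) K].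

Definition fits (B h : nat) (K : seq nat) : bool :=
  (size K <= B)%N && all (fun kj => kj <= h)%N K.

Definition Omega (n B h : nat) (K : seq nat) : {set clause n} :=
  [set c : clause n | (#|vars c| == sumn K) &&
    [exists f : {ffun 'I_(size K) -> 'I_B}, injectiveb f &&
      [forall j, #|vars c :&: community n h (f j)| == nth 0%N K j]]]%SET.

Definition unif (R : realType) (X : finType) (A : {set X}) (x : X) : R :=
  (x \in A)%:R / #|A|%:R.

Definition mixture (R : realType) (T : nat) (K : 'I_T -> seq nat) (p : 'I_T -> R)
    (n B h : nat) (c : clause n) : R :=
  \sum_t p t * unif R (Omega n B h (K t)) c.

(* Probability of the event E for m independent clauses of law mu. *)
Definition Pr (R : realType) (n m : nat) (mu : clause n -> R)
    (E : pred (instance n m)) : R :=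
  \sum_(I : instance n m | E I) \prod_i mu (I i).

(* Probability of E in F(n, m(n), B(n), P), as a function of n; h(n) is the
   common size of the communities. *)
Definition prF (R : realType) (T : nat) (K : 'I_T -> seq nat) (p : 'I_T -> R)
    (B h m : nat -> nat) (E : forall n l, pred (instance n l)) (n : nat) : R :=
  Pr (mixture K p (B n) (h n)) (@E n (m n)).

Definition pr_ksat (R : realType) (k m : nat) (E : forall n l, pred (instance n l))
    (n : nat) : R :=
  Pr (unif R [set c : clause n | #|vars c| == k]%SET) (@E n m).

(* r_k^*: the bound 0 <= alpha keeps the set bounded below, since [Num.truncn]
   is 0 on negative numbers and [inf] is 0 on sets without a lower bound. *)
Definition rstar (R : realType) (k : nat) : R :=
  inf [set alpha : R | 0 <= alpha /\
    (fun n => pr_ksat R k (Num.truncn (alpha * n%:R)) unsat n) @ \oo --> (1 : R)].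

(* The filter "n -> oo along N", for a set N of numbers of variables: n is a
   multiple of the community size, so in general not every n is admissible. *)
Notation along N := (within N \oo) (only parsing).

Definition natfun (R : realType) (f : nat -> nat) (n : nat) : R := (f n)%:R.

(* Main.v *)
(** The communities are disjoint, so an instance is unsatisfiable as soon as the
    clauses of type (k) inside one community contain all 2^k sign patterns on a
    fixed set of k variables. Put L = 2^k. A second moment computation on the
    number of ways this happens, the L patterns being looked for in L disjoint
    blocks of m/L clauses so that distinct patterns are independent, bounds the
    probability of SAT by 1 / (1 + c B (min(1, m/B) / h^k)^L). This is already
    enough for the unsatisfiability claims of (a) and, since h is at most
    logarithmic, for (b), (c) and (d), where n (m/n)^L grows like a positive
    power of n. In (d) one can take eps0 = r_k^*, so that alpha > 0; this needs
    r_k^* > 0, i.e. that very sparse random k-SAT is not unsatisfiable w.h.p.,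
    which follows from a union bound over sets of s clauses covering at most
    (k-1) s variables.

    Conversely, fewer than L clauses on k variables each are always satisfiable,
    so when T = 1 the instance is satisfiable if no community receives L clauses.
    Revealing the clauses one by one, the conditional probability that the next
    one completes L clauses in a community is at most (2m/B)^(L-1), whence the
    lower bound (1 - (2m/B)^(L-1))^m on the probability of SAT. *)

Require Import Defs.
From HB Require Import structures.
From mathcomp Require Import all_boot all_order all_algebra.
From mathcomp Require Import all_classical all_reals all_analysis.
From mathcomp Require Import zify ring lra.
Set Implicit Arguments.
Unset Strict Implicit.
Unset Printing Implicit Defensive.
Import Order.TTheory GRing.Theory Num.Theory.
Import numFieldNormedType.Exports.
Local Open Scope ring_scope.

(** * Expectation over a product space *)

Definition expect (R : realType) (J X : finType) (mu : X -> R)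
    (f : {ffun J -> X} -> R) : R :=
  \sum_(I : {ffun J -> X}) (\prod_j mu (I j)) * f I.

Section Expectation.
Variables (R : realType) (J X : finType) (mu : X -> R).
Hypothesis mu_ge0 : forall x, 0 <= mu x.
Hypothesis mu_sum1 : \sum_x mu x = 1.

Local Notation E := (@expect R J X mu).

Lemma weight_ge0 (I : {ffun J -> X}) : 0 <= \prod_j mu (I j).
Proof. by apply: prodr_ge0. Qed.

Lemma le_expect f g : (forall I, f I <= g I) -> E f <= E g.
Proof. by move=> fg; apply: ler_sum => I _; rewrite ler_wpM2l ?weight_ge0. Qed.

Lemma expect_ge0 f : (forall I, 0 <= f I) -> 0 <= E f.
Proof. by move=> f0; apply: sumr_ge0 => I _; rewrite mulr_ge0 ?weight_ge0. Qed.

Lemma eq_expect f g : f =1 g -> E f = E g.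
Proof. by move=> fg; apply: eq_bigr => I _; rewrite fg. Qed.

Lemma expect_sum (S : Type) (r : seq S) (P : pred S) (f : S -> {ffun J -> X} -> R) :
  E (fun I => \sum_(s <- r | P s) f s I) = \sum_(s <- r | P s) E (f s).
Proof.
rewrite /expect exchange_big /=; apply: eq_bigr => I _.
by rewrite mulr_sumr.
Qed.

Lemma expectD f g : E (fun I => f I + g I) = E f + E g.
Proof. by rewrite /expect -big_split; apply: eq_bigr => I _; rewrite /= mulrDr. Qed.

Lemma expectZ c f : E (fun I => c * f I) = c * E f.
Proof. by rewrite /expect mulr_sumr; apply: eq_bigr => I _; rewrite mulrCA. Qed.

(** The product over [D] is completed by factors 1, so the sum over functions factorises; each
    coordinate outside [D] contributes the total mass 1. *)
Lemma expect_prod (D : {pred J}) (g : J -> X -> R) :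
  E (fun I => \prod_(j in D) g j (I j)) = \prod_(j in D) \sum_x mu x * g j x.
Proof.
rewrite /expect; transitivity (\prod_j \sum_x mu x * (if j \in D then g j x else 1)).
  rewrite bigA_distr_bigA; apply: eq_bigr => I _.
  by rewrite big_split /=; congr (_ * _); rewrite big_mkcond.
rewrite [RHS]big_mkcond; apply: eq_bigr => j _; case: ifP => // _.
by rewrite -[RHS]mu_sum1; apply: eq_bigr => x _; rewrite mulr1.
Qed.

Lemma expect_cst c : E (fun=> c) = c.
Proof.
rewrite /expect -mulr_suml -(bigA_distr_bigA (fun _ : J => mu)) /=.
by rewrite big1 ?mul1r.
Qed.

(* Exchanging the coordinates outside D between two independent copies of the
   sample preserves their joint law. *)
Lemma expect_indep (D : {pred J}) (f g : {ffun J -> X} -> R) :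
  (forall I I' : {ffun J -> X}, {in D, I =1 I'} -> f I = f I') ->
  (forall I I' : {ffun J -> X}, {in [predC D], I =1 I'} -> g I = g I') ->
  E (fun I => f I * g I) = E f * E g.
Proof.
move=> fD gD.
pose mix (I I' : {ffun J -> X}) := [ffun j => if j \in D then I j else I' j].
pose w (I : {ffun J -> X}) := \prod_j mu (I j).
pose h (u : {ffun J -> X} * {ffun J -> X}) := (mix u.1 u.2, mix u.2 u.1).
have hK : involutive h.
  move=> [I I']; rewrite /h /=; congr (_, _); apply/ffunP => j;
  by rewrite /mix !ffunE; case: (j \in D).
have wmix I I' : w (mix I I') * w (mix I' I) = w I * w I'.
  rewrite /w -!big_split; apply: eq_bigr => j _ /=; rewrite !ffunE.
  by case: ifP => // _; rewrite mulrC.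
(* The factor 1 is written as the expectation of 1 over a second copy; both sides become double
   sums, matched by the involution [h]. *)
rewrite -[LHS]mulr1 -(expect_cst 1) /expect !big_distrlr /=.
rewrite !pair_big /= (reindex_inj (inv_inj hK)) /=.
apply: eq_bigr => -[I I'] _ /=; rewrite -!/(w _) mulr1.
rewrite (fD _ I); last by move=> j jD; rewrite ffunE jD.
rewrite (gD _ I'); last by move=> j; rewrite inE ffunE => /negbTE ->.
by rewrite mulrAC wmix; ring.
Qed.

(** Induction on [r]: as the blocks are disjoint, the remaining factors only read coordinates
    outside [D a]. *)
Lemma expect_indep_prod (A : eqType) (r : seq A) (D : A -> {pred J})
    (f : A -> {ffun J -> X} -> R) :
  uniq r -> (forall a b j, j \in D a -> j \in D b -> a = b) ->
  (forall a (I I' : {ffun J -> X}), {in D a, I =1 I'} -> f a I = f a I') ->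
  E (fun I => \prod_(a <- r) f a I) = \prod_(a <- r) E (f a).
Proof.
move=> + Dinj fD; elim: r => [|a r IHr] /=.
  by rewrite big_nil (eq_expect (g := fun=> 1)) ?expect_cst // => I; rewrite big_nil.
case/andP=> ar ur; rewrite big_cons -IHr // -(@expect_indep (D a)).
- by apply: eq_expect => I; rewrite big_cons.
- exact: fD.
move=> I I' eqI; apply: eq_big_seq => b br; apply: fD => j jb; apply: eqI.
rewrite inE; apply/negP => ja; move: ar; rewrite (Dinj _ _ _ ja jb).
by rewrite br.
Qed.

End Expectation.

(** A sample with a coordinate of mass 0 has weight 0. This allows the clauses drawn to be assumed
    of the prescribed type. *)
Lemma le_expect_supp (R : realType) (J X : finType) (mu : X -> R)
    (f g : {ffun J -> X} -> R) :
  (forall x, 0 <= mu x) ->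
  (forall I : {ffun J -> X}, (forall j, mu (I j) != 0) -> f I <= g I) -> expect mu f <= expect mu g.
Proof.
move=> mu0 fg; apply: ler_sum => I _.
case: (pickP (fun j => mu (I j) == 0)) => [j /eqP Ij|no].
  by rewrite (bigD1 j) //= Ij !mul0r.
by rewrite ler_wpM2l ?prodr_ge0 // fg // => j; rewrite no.
Qed.

Lemma PrE (R : realType) (n m : nat) (mu : clause n -> R) (A : pred (instance n m)) :
  Pr mu A = expect mu (fun I : instance n m => (A I)%:R).
Proof.
rewrite /Pr /expect big_mkcond; apply: eq_bigr => I _.
by case: (A I); rewrite ?mulr1 ?mulr0.
Qed.

Lemma Pr_unsat (R : realType) (n m : nat) (mu : clause n -> R) :
  \sum_c mu c = 1 -> Pr mu (@unsat n m) = 1 - Pr mu (@sat n m).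
Proof.
move=> mu1; rewrite !PrE; apply: (addIr (expect mu (fun I : instance n m => (sat I)%:R))).
rewrite subrK -expectD -[RHS](@expect_cst R 'I_m _ mu mu1).
apply: eq_expect => I; rewrite /unsat.
by case: (sat I); rewrite ?addr0 ?add0r.
Qed.

(** * Counting clauses *)

Definition kclauses (n k : nat) (V : {set 'I_n}) : {set clause n} :=
  [set c : clause n | (#|vars c| == k) && (vars c \subset V)]%SET.

Lemma card_clauses_on (n : nat) (W : {set 'I_n}) :
  #|[set c : clause n | vars c == W]%SET| = (2 ^ #|W|)%N.
Proof.
(* The signs are the values other than [None], so the clauses with variable set [W] are the
   functions of support [W] counted by [card_pffun_on]. *)
have -> : 2%N = #|predC1 (None : option bool)|.
  by rewrite cardC1 card_option card_bool.
rewrite -(card_pffun_on None W); apply: eq_card => c; rewrite inE.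
apply/eqP/pfamilyP => [<- | [cW cW']].
  split; first by apply/fintype.subsetP => v; rewrite /vars !inE.
  by move=> v; rewrite /vars !inE.
apply/setP => v; apply/idP/idP; rewrite /vars inE => vW.
  by apply: (fintype.subsetP cW).
exact: cW'.
Qed.

Lemma card_kclauses (n k : nat) (V : {set 'I_n}) :
  #|kclauses k V| = ('C(#|V|, k) * 2 ^ k)%N.
Proof.
rewrite -cards_draws -sum1_card (partition_big (@vars n) (fun W : {set 'I_n} => W \in [set W : {set 'I_n} | W \subset V & #|W| == k]%SET)); last first.
  by move=> c; rewrite !inE andbC.
rewrite -sum_nat_const; apply: eq_bigr => W; rewrite inE => /andP[WV /eqP <-].
rewrite sum1_card -card_clauses_on; apply: eq_card => c; rewrite inE unfold_in inE.
by case: (vars c =P W) => [->|]; rewrite ?andbF // eqxx WV.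
Qed.

(** The set is the image of [j |-> b * h + j] on ['I_a]: the first [a] variables of community [b].
    It supplies the variables of the explicit clauses below. *)
Lemma card_segment (n h b a : nat) : (a <= h)%N -> (b.+1 * h <= n)%N ->
  #|[set v : 'I_n | (v %/ h == b)%N && (v %% h < a)%N]%SET| = a.
Proof.
move=> ah bn.
have lt (j : 'I_a) : (b * h + j < n)%N by have := ltn_ord j; lia.
rewrite -[RHS]card_ord -(card_imset _ (f := fun j => Ordinal (lt j))); last first.
  by move=> i j /(congr1 val) /= /addnI /val_inj.
apply: eq_card => v; rewrite !inE; apply/andP/imsetP => [[/eqP vb va]|[j _ ->]] /=.
  exists (Ordinal va) => //; apply: val_inj; rewrite /= -vb.
  exact: divn_eq.
have jh : (j < h)%N by apply: leq_trans ah.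
by rewrite divnMDl ?divn_small ?modnMDl ?modn_small ?addn0 //; lia.
Qed.

Lemma card_community (n h b : nat) : (0 < h)%N -> (b.+1 * h <= n)%N ->
  #|community n h b| = h.
Proof.
move=> h0 bn; rewrite -[RHS](card_segment (leqnn h) bn).
by apply: eq_card => v; rewrite !inE ltn_mod h0 andbT.
Qed.

Lemma community_disjoint (n h b b' : nat) (v : 'I_n) :
  v \in community n h b -> v \in community n h b' -> b = b'.
Proof. by rewrite !inE => /eqP <- /eqP. Qed.

Lemma card_communities (n h s : nat) (A : {set 'I_n}) :
  (forall v, v \in A -> (v %/ h < s)%N) ->
  #|A| = (\sum_(j < s) #|A :&: community n h j|)%N.
Proof.
move=> As; rewrite -sum1_card.
transitivity (\sum_(v in A) \sum_(j < s) (v \in community n h j))%N.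
  apply: eq_bigr => v /As vs; rewrite (bigD1 (Ordinal vs)) //= inE eqxx big1 // => j.
  by rewrite inE eq_sym => /negbTE; rewrite -val_eqE /= => ->.
rewrite exchange_big; apply: eq_bigr => j _ /=.
rewrite -sum1_card [RHS](eq_bigl (fun v => (v \in A) && (v \in community n h j))) => [|v]; last by rewrite inE.
by rewrite big_mkcondr; apply: eq_bigr => v _; case: (v \in community _ _ _).
Qed.

(** The only community of the type contains [k] of the [k] variables, hence all of them. *)
Lemma mem_Omega1 (n B h k : nat) (c : clause n) : (0 < k)%N ->
  (c \in Omega n B h [:: k]) = [exists b : 'I_B, c \in kclauses k (community n h b)].
Proof.
move=> k0; rewrite inE /= addn0; apply/andP/existsP => [[ck /existsP[f /andP[_ /forallP/(_ ord0) /= /eqP fk]]]|[b]].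
  exists (f ord0); rewrite inE ck /=; apply/finset.setIidPl/eqP.
  by rewrite eqEcard finset.subsetIl /= fk (eqP ck).
rewrite inE => /andP[ck cb]; split=> //; apply/existsP.
exists [ffun=> b]; apply/andP; split.
  by apply/injectiveP => i j _; rewrite !ord1.
by apply/forallP => j; rewrite ffunE (finset.setIidPl cb) !ord1 /= (eqP ck).
Qed.

Lemma kclauses_disjoint (n h k b b' : nat) (c : clause n) : (0 < k)%N ->
  c \in kclauses k (community n h b) -> c \in kclauses k (community n h b') -> b = b'.
Proof.
move=> k0; rewrite !inE => /andP[/eqP ck cb] /andP[_ cb'].
have /card_gt0P[v vc] : (0 < #|vars c|)%N by rewrite ck.
exact: community_disjoint (fintype.subsetP cb _ vc) (fintype.subsetP cb' _ vc).
Qed.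

(** As [k > 0], a clause lies inside at most one community, so the count is a sum over the
    communities. *)
Lemma card_Omega1 (n B h k : nat) : (0 < k)%N -> (0 < h)%N -> n = (B * h)%N ->
  #|Omega n B h [:: k]| = (B * ('C(h, k) * 2 ^ k))%N.
Proof.
move=> k0 h0 nBh; rewrite -sum1_card.
transitivity (\sum_(c : clause n) \sum_(b < B) (c \in kclauses k (community n h b)))%N.
  rewrite big_mkcond; apply: eq_bigr => c _; rewrite mem_Omega1 //.
  case: existsP => [[b cb]|/forallNP cN]; last by rewrite big1 // => b _; case: (boolP (_ \in _)) => // /cN.
  rewrite (bigD1 b) //= cb big1 // => b' b'b; case: (boolP (_ \in _)) => // cb'.
  by rewrite -val_eqE /= (kclauses_disjoint k0 cb' cb) eqxx in b'b.
rewrite exchange_big /= -[X in (X * _)%N]card_ord -sum_nat_const; apply: eq_bigr => b _.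
rewrite -big_mkcond sum1_card card_kclauses card_community // nBh.
by rewrite leq_mul2r ltn_ord orbT.
Qed.

(** All variables lie in one community [b], while each part of [K], being positive, forces a
    variable into its own community. Injectivity of [f] leaves a single part, equal to [k]. Hence
    only one component of the mixture charges a clause of type [(k)]. *)
Lemma Omega1_disjoint (n B h k : nat) (K : seq nat) (c : clause n) : (0 < k)%N ->
  is_clause_type K -> c \in Omega n B h [:: k] -> c \in Omega n B h K -> K = [:: k].
Proof.
move=> k0 /and3P[K0 _ /all_nthP K1]; rewrite mem_Omega1 // => /existsP[b].
rewrite !inE => /andP[/eqP ck cb] /andP[cK /existsP[f /andP[/injectiveP finj /forallP fK]]].
have fb j : f j = b.
  have : (0 < #|vars c :&: community n h (f j)|)%N by rewrite (eqP (fK j)) K1.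
  case/card_gt0P => v; rewrite inE => /andP[vc vj]; apply: val_inj.
  exact: community_disjoint vj (fintype.subsetP cb _ vc).
have K2 : (size K <= 1)%N.
  rewrite leqNgt; apply/negP => K2.
  have /(congr1 val) // : Ordinal (ltnW K2) = Ordinal K2 by apply: finj; rewrite !fb.
by move: cK K0 K2; rewrite ck; case: (K) => [|x []] //= /eqP; rewrite addn0 => ->.
Qed.

Lemma Omega_neq0 (n B h : nat) (K : seq nat) : (0 < h)%N -> n = (B * h)%N ->
  fits B h K -> (0 < #|Omega n B h K|)%N.
Proof.
move=> h0 nBh /andP[KB /all_nthP Kh]; apply/card_gt0P.
(* The witness has positive literals on the first [nth 0 K j] variables of community [j], for each
   [j < size K]. *)
pose c : clause n := [ffun v : 'I_n =>
  if ((v %/ h < size K) && (v %% h < nth 0 K (v %/ h)))%N then Some true else None].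
have cE v : (v \in vars c) = ((v %/ h < size K) && (v %% h < nth 0 K (v %/ h)))%N.
  by rewrite inE ffunE; case: ifP.
have cK (j : 'I_(size K)) : #|vars c :&: community n h j| = nth 0%N K j.
  rewrite -[RHS](@card_segment n h j) ?Kh //; last first.
    by rewrite nBh leq_mul2r (leq_trans (ltn_ord j)) ?orbT.
  apply: eq_card => v; rewrite inE cE !inE andbC; case: eqP => //= ->.
  by rewrite ltn_ord.
exists c; rewrite inE (@card_communities n h (size K)); last first.
  by move=> v; rewrite cE => /andP[].
apply/andP; split.
  by rewrite sumnE (big_nth 0%N) big_mkord; apply/eqP/eq_bigr => j _; apply: cK.
apply/existsP; exists [ffun j => widen_ord KB j]; apply/andP; split.
  by apply/injectiveP => i j; rewrite !ffunE => /(congr1 val) /= /val_inj.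
by apply/forallP => j; rewrite ffunE /= cK.
Qed.

(** * Uniform laws and the mixture of clause types *)

Lemma unif_ge0 (R : realType) (X : finType) (A : {set X}) x : 0 <= unif R A x.
Proof. by rewrite /unif divr_ge0. Qed.

Lemma sum_unif (R : realType) (X : finType) (A S : {set X}) :
  \sum_(x in S) unif R A x = #|A :&: S|%:R / #|A|%:R.
Proof.
rewrite /unif -mulr_suml; congr (_ / _); rewrite -natr_sum -sum1_card; congr _%:R.
rewrite [RHS](eq_bigl (fun x => (x \in S) && (x \in A))) => [|x]; last by rewrite inE andbC.
by rewrite big_mkcondr; apply: eq_bigr => x _; case: (x \in A).
Qed.

Lemma sum_unif1 (R : realType) (X : finType) (A : {set X}) : (0 < #|A|)%N ->
  \sum_x unif R A x = 1.
Proof.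
move=> A0; rewrite (eq_bigl (fun x => x \in [set: X]%SET)) => [|x]; last by rewrite inE.
by rewrite sum_unif finset.setIT divff // pnatr_eq0 -lt0n.
Qed.

Section Mixture.
Variables (R : realType) (T : nat) (K : 'I_T -> seq nat) (p : 'I_T -> R) (k n B h : nat).
Hypotheses (K_type : forall t, is_clause_type (K t)) (K_inj : injective K)
  (p_gt0 : forall t, 0 < p t) (p_sum1 : \sum_t p t = 1)
  (nBh : n = (B * h)%N) (K_fits : forall t, fits B h (K t)).
Variable t0 : 'I_T.
Hypothesis K_k : K t0 = [:: k].

Lemma k_gt0 : (0 < k)%N.
Proof. by have := K_type t0; rewrite K_k => /and3P[_ _]; rewrite /= andbT. Qed.

Lemma k_le_h : (k <= h)%N.
Proof. by have := K_fits t0; rewrite K_k => /andP[_]; rewrite /= andbT. Qed.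

Lemma h_gt0 : (0 < h)%N.
Proof. exact: leq_trans k_gt0 k_le_h. Qed.

Lemma B_gt0 : (0 < B)%N.
Proof. by have := K_fits t0; rewrite K_k => /andP[]. Qed.

Lemma mixture_ge0 (c : clause n) : 0 <= mixture K p B h c.
Proof. by apply: sumr_ge0 => t _; rewrite mulr_ge0 ?unif_ge0 // ltW. Qed.

Lemma mixture_sum1 : \sum_(c : clause n) mixture K p B h c = 1.
Proof.
rewrite exchange_big -[RHS]p_sum1; apply: eq_bigr => t _ /=.
by rewrite -mulr_sumr sum_unif1 ?mulr1 // Omega_neq0 // h_gt0.
Qed.

Lemma mixtureE (c : clause n) : c \in Omega n B h [:: k] ->
  mixture K p B h c = p t0 / (B * ('C(h, k) * 2 ^ k))%:R.
Proof.
move=> ck; rewrite /mixture (bigD1 t0) //= K_k /unif ck mul1r card_Omega1 ?h_gt0 ?k_gt0 //.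
rewrite big1 ?addr0 // => t tt0; case: (boolP (c \in _)) => [ct|]; last by rewrite mul0r mulr0.
by rewrite (K_inj (etrans (Omega1_disjoint k_gt0 (K_type t) ck ct) (esym K_k))) eqxx in tt0.
Qed.

Lemma mixture1 : T = 1%N -> mixture K p B h =1 unif R (Omega n B h [:: k]).
Proof.
move=> T1 c; have tE t : t = t0 by move: t t0; rewrite T1 => t t'; rewrite !ord1.
have p1 : p t0 = 1 by rewrite -[RHS]p_sum1 (bigD1 t0) //= big1 ?addr0 // => t; rewrite (tE t) eqxx.
rewrite /mixture (bigD1 t0) //= big1 ?addr0 => [|t]; last by rewrite (tE t) eqxx.
by rewrite p1 mul1r K_k.
Qed.

End Mixture.

(** * The second moment method *)

Section SecondMoment.
Variables (R : realType) (J X S C : finType) (mu : X -> R).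
Variables (D : S -> {set J}) (w : C -> S -> X) (d : nat) (pi : R).
Hypotheses (mu_ge0 : forall x, 0 <= mu x) (mu_sum1 : \sum_x mu x = 1).
Hypothesis D_card : forall s, #|D s| = d.
Hypothesis D_disj : forall s s' j, j \in D s -> j \in D s' -> s = s'.
Hypothesis w_inj : forall s b b', w b s = w b' s -> b = b'.
Hypothesis w_mu : forall b s, mu (w b s) = pi.

Local Notation E := (@expect R J X mu).

Lemma expect_coord (j : J) (g : X -> R) : E (fun I => g (I j)) = \sum_x mu x * g x.
Proof.
transitivity (E (fun I => \prod_(i in pred1 j) (fun=> g) i (I i))).
  by apply: eq_expect => I; rewrite big_pred1_eq.
by rewrite (expect_prod mu_sum1 (pred1 j) (fun=> g)) big_pred1_eq.
Qed.

Lemma sum_pick (x : X) : \sum_y mu y * (y == x)%:R = mu x.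
Proof.
by rewrite (bigD1 x) //= eqxx mulr1 big1 ?addr0 // => y /negbTE ->; rewrite mulr0.
Qed.

(** In the application [S] is the set of sign patterns, [C] the set of communities and [w b s] the
    clause with signs [s] sought in community [b]; [Z] counts its occurrences in block [D s]. *)
Let Z b s (I : {ffun J -> X}) : R := \sum_(j in D s) (I j == w b s)%:R.

Let Z_local b s (I I' : {ffun J -> X}) : {in D s, I =1 I'} -> Z b s I = Z b s I'.
Proof. by move=> II'; apply: eq_bigr => j js; rewrite II'. Qed.

Let EZ b s : E (Z b s) = d%:R * pi.
Proof.
rewrite expect_sum (eq_bigr (fun=> pi)) => [|j _].
  by rewrite sumr_const D_card mulr_natl.
by rewrite (expect_coord j (fun x => (x == w b s)%:R)) sum_pick w_mu.
Qed.

(** Two distinct coordinates are independent and contribute [pi ^+ 2]; a single coordinate can hit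
    both targets only if [b = b'], by [w_inj]. *)
Let EZZ b b' s :
  E (fun I => Z b s I * Z b' s I) <= (d%:R * pi) ^+ 2 + (b == b')%:R * (d%:R * pi).
Proof.
have pair (j j' : J) : E (fun I => (I j == w b s)%:R * (I j' == w b' s)%:R) <=
    pi ^+ 2 + (j == j')%:R * ((b == b')%:R * pi).
  case: (eqVneq j j') => [<-|jj'].
    rewrite (expect_coord j (fun x => (x == w b s)%:R * (x == w b' s)%:R)) mul1r.
    apply: (@le_trans _ _ ((b == b')%:R * pi)); last by rewrite lerDr sqr_ge0.
    case: (eqVneq b b') => [<-|bb'].
      rewrite mul1r -(w_mu b s) -sum_pick; apply: ler_sum => x _.
      by rewrite ler_wpM2l // -natrM mulnb andbb.
    rewrite mul0r big1 // => x _; rewrite -natrM mulnb.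
    case: eqP => [->|_]; rewrite ?mulr0 //=; case: eqP => [/w_inj bE|_]; last by rewrite mulr0.
    by rewrite bE eqxx in bb'.
  rewrite mul0r addr0 (@expect_indep _ _ _ _ mu_sum1 (pred1 j)
    (fun I => (I j == w b s)%:R) (fun I => (I j' == w b' s)%:R)).
  - rewrite (expect_coord j (fun x => (x == w b s)%:R)).
    by rewrite (expect_coord j' (fun x => (x == w b' s)%:R)) !sum_pick !w_mu.
  - by move=> I I' II'; rewrite II' ?inE.
  - by move=> I I' II'; rewrite II' // !inE eq_sym.
rewrite (@eq_expect _ _ _ _ _ (fun I => \sum_(j in D s) \sum_(j' in D s)
  (I j == w b s)%:R * (I j' == w b' s)%:R)) => [|I]; last first.
  by rewrite /Z mulr_suml; apply: eq_bigr => j _; rewrite mulr_sumr.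
rewrite expect_sum; apply: (@le_trans _ _ (\sum_(j in D s) \sum_(j' in D s)
   (pi ^+ 2 + (j == j')%:R * ((b == b')%:R * pi)))).
  by apply: ler_sum => j _; rewrite expect_sum; apply: ler_sum => j' _.
rewrite (eq_bigr (fun=> d%:R * pi ^+ 2 + (b == b')%:R * pi)) => [|j js].
  by rewrite sumr_const D_card -mulr_natl; lra.
rewrite big_split /= sumr_const D_card; congr (_ + _); first by rewrite mulr_natl.
by rewrite (bigD1 j) //= eqxx big1 ?addr0 ?mul1r // => i /andP[_]; rewrite eq_sym => /negbTE ->; rewrite mul0r.
Qed.

(** [W] counts, with multiplicity, the [b] all of whose targets are hit, so it vanishes on [A]. Its
    mean is [M] and its second moment at most [M * (M + U)]; the bound then follows from the
    expectation of [(1 - t * W) ^+ 2], which dominates the indicator of [A]. *)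
Lemma second_moment_bound (A : pred {ffun J -> X}) :
  (0 < #|C|)%N -> 0 < d%:R * pi ->
  (forall I, A I -> forall b, exists s, forall j, j \in D s -> I j != w b s) ->
  E (fun I => (A I)%:R) <=
    (1 + d%:R * pi) ^+ #|S| / (#|C|%:R * (d%:R * pi) ^+ #|S| + (1 + d%:R * pi) ^+ #|S|).
Proof.
move=> C0; set x := d%:R * pi => x0 AZ; set U := (1 + x) ^+ #|S|.
pose W (I : {ffun J -> X}) := \sum_b \prod_s Z b s I.
pose M : R := #|C|%:R * x ^+ #|S|.
have U0 : 0 < U by rewrite exprn_gt0 // addr_gt0.
have M0 : 0 < M by rewrite mulr_gt0 ?ltr0n ?exprn_gt0.
have EW : E W = M.
  rewrite expect_sum /M -sumr_const mulr_suml; apply: eq_bigr => b _; rewrite mul1r.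
  rewrite (@expect_indep_prod _ _ _ _ mu_sum1 _ _ (fun s => mem (D s))) ?index_enum_uniq //.
    by rewrite (eq_bigr (fun=> x)) ?prodr_const // => s _; apply: EZ.
  by move=> s I I' II'; apply: Z_local.
have EWW : E (fun I => W I * W I) <= M * (M + U).
  rewrite (@eq_expect _ _ _ _ _ (fun I => \sum_b \sum_b' \prod_s (Z b s I * Z b' s I))) => [|I]; last first.
    rewrite /W mulr_suml; apply: eq_bigr => b _; rewrite mulr_sumr.
    by apply: eq_bigr => b' _; rewrite big_split.
  (* The product is spread over the pairs [(b, b')]: a pair with [b != b'] has expectation at most
     [x ^+ #|S| * x ^+ #|S|], and a diagonal one at most [(x * (1 + x)) ^+ #|S| = x ^+ #|S| * U]. *)
  have -> : M * (M + U) = \sum_(b : C) \sum_(b' : C) (x ^+ #|S| * x ^+ #|S| + (b == b')%:R * (x ^+ #|S| * U)).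
    rewrite (eq_bigr (fun=> M * x ^+ #|S| + x ^+ #|S| * U)) => [|b _].
      by rewrite sumr_const -mulr_natl /M; ring.
    rewrite big_split /= sumr_const -[in LHS]mulr_natl /M mulrA; congr (_ + _).
    by rewrite (bigD1 b) //= eqxx big1 ?addr0 ?mul1r // => i; rewrite eq_sym => /negbTE ->; rewrite mul0r.
  rewrite expect_sum; apply: ler_sum => b _; rewrite expect_sum; apply: ler_sum => b' _.
  rewrite (@expect_indep_prod _ _ _ _ mu_sum1 _ _ (fun s => mem (D s))) ?index_enum_uniq //; last first.
    by move=> s I I' II'; congr (_ * _); apply: Z_local.
  apply: (@le_trans _ _ (\prod_(s : S) (x ^+ 2 + (b == b')%:R * x))).
    apply: ler_prod => s _; rewrite EZZ andbT; apply: expect_ge0 => // I.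
    by rewrite mulr_ge0 // sumr_ge0.
  rewrite prodr_const; case: eqP => _.
    have -> : x ^+ 2 + 1 * x = x * (1 + x) by ring.
    by rewrite mul1r /U exprMn lerDr mulr_ge0 // exprn_ge0 // ltW.
  by rewrite !mul0r !addr0 -exprMn -expr2.
(* This [t] minimises [1 - 2 * t * M + t ^+ 2 * (M * (M + U))]. *)
pose t := (M + U)^-1.
have t0 : 0 < t by rewrite invr_gt0 addr_gt0.
have -> : U / (M + U) = 1 - 2 * t * M + t ^+ 2 * (M * (M + U)).
  by rewrite /t; field; rewrite gt_eqF ?addr_gt0.
apply: (@le_trans _ _ (E (fun I => 1 + ((- 2 * t) * W I + t ^+ 2 * (W I * W I))))).
  apply: le_expect => // I; case: (boolP (A I)) => [/AZ AI|_]; last first.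
    by have := sqr_ge0 (1 - t * W I); rewrite -[false%:R]/(0 : R); lra.
  suff -> : W I = 0 by rewrite !mulr0 !addr0.
  rewrite /W big1 // => b _; have [s sb] := AI b.
  rewrite (bigD1 s) //= [Z b s I]big1 ?mul0r // => j js.
  by rewrite (negbTE (sb j js)).
rewrite expectD (expect_cst _ mu_sum1) expectD !expectZ EW -addrA lerD2l mulNr mulNr lerD2l.
by rewrite ler_wpM2l ?sqr_ge0.
Qed.

End SecondMoment.

(** * Upper bounds on the probability of satisfiability *)

Section UnsatPattern.
Variables (n B h k : nat).
Hypotheses (k_gt0 : (0 < k)%N) (kh : (k <= h)%N) (nBh : n = (B * h)%N).

(** The clause on the first [k] variables of community [b] with signs [s]; [insub] fails at
    positions from [k] on, which gives [None] there. *)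
Definition pattern (b : 'I_B) (s : {ffun 'I_k -> bool}) : clause n :=
  [ffun v : 'I_n => if (v %/ h == b)%N then omap s (insub (v %% h)%N) else None].

Lemma vars_pattern b s :
  vars (pattern b s) = [set v : 'I_n | (v %/ h == b)%N && (v %% h < k)%N]%SET.
Proof.
apply/setP => v; rewrite !inE ffunE; case: ifP => //= _.
case: (insubP 'I_k (v %% h)%N) => [j jk _|jk].
  by rewrite jk.
by rewrite (negbTE jk).
Qed.

Lemma pattern_kclauses b s : pattern b s \in kclauses k (community n h b).
Proof.
rewrite inE vars_pattern card_segment // ?eqxx; last first.
  by rewrite nBh leq_mul2r ltn_ord orbT.
by apply/fintype.subsetP => v; rewrite !inE => /andP[].
Qed.

Lemma pattern_Omega b s : pattern b s \in Omega n B h [:: k].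
Proof. by rewrite mem_Omega1 //; apply/existsP; exists b; apply: pattern_kclauses. Qed.

Lemma pattern_inj s b b' : pattern b s = pattern b' s -> b = b'.
Proof.
move=> e; apply/val_inj/(kclauses_disjoint k_gt0 (pattern_kclauses b s)).
by rewrite e pattern_kclauses.
Qed.

Lemma pattern_falsified (a : {ffun 'I_n -> bool}) (b : 'I_B) :
  exists s, ~~ satisfies a (pattern b s).
Proof.
(* The signs are opposite to [a] on the first [k] variables of [b]. The quantifier over [v] reads
   [a] at [b * h + j] without first making that number an ordinal. *)
exists [ffun j : 'I_k => ~~ [exists v : 'I_n, (v == b * h + j :> nat)%N && a v]].
apply/existsPn => v; rewrite ffunE; case: ((v %/ h)%N =P b) => // vb.
case: (insubP 'I_k (v %% h)%N) => //= j _ jE; rewrite ffunE; apply/eqP => -[].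
case: (boolP (a v)) => av; last first.
  case: existsP => //= -[v' /andP[/eqP v'E]]; have -> : v' = v; last by rewrite (negbTE av).
  by apply: val_inj; rewrite /= v'E jE -vb -divn_eq.
suff -> : [exists v0 : 'I_n, (v0 == b * h + j :> nat)%N && a v0] by [].
by apply/existsP; exists v; rewrite av andbT jE -vb -divn_eq.
Qed.

Lemma sat_pattern (m : nat) (I : instance n m) (b : 'I_B) :
  sat I -> exists s, forall i, I i != pattern b s.
Proof.
case/existsP => a /forallP aI; have [s] := pattern_falsified a b.
by move=> sN; exists s => i; apply: contra sN => /eqP <-.
Qed.

End UnsatPattern.

Lemma ffact_le_exp (n k : nat) : (n ^_ k <= n ^ k)%N.
Proof.
elim: k n => [|k IHk] [|n] //; rewrite ffactnS expnS leq_mul //=.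
by apply: leq_trans (IHk n) _; case: k {IHk} => // k; rewrite leq_exp2r.
Qed.

Lemma bin_le_exp (n k : nat) : ('C(n, k) <= n ^ k)%N.
Proof.
by apply: leq_trans (ffact_le_exp n k); rewrite -bin_ffact leq_pmulr ?fact_gt0.
Qed.

Section SatUpper.
Variables (R : realType) (T : nat) (K : 'I_T -> seq nat) (p : 'I_T -> R) (k : nat).
Hypotheses (K_type : forall t, is_clause_type (K t)) (K_inj : injective K)
  (p_gt0 : forall t, 0 < p t) (p_sum1 : \sum_t p t = 1).
Variable t0 : 'I_T.
Hypothesis K_k : K t0 = [:: k].

(** [second_moment_bound] for the clauses [pattern b s]. The blocks are intervals of [m %/ 2 ^ k]
    clause indices, numbered by [enum_rank] and expressed by reusing [community]; [x] is the
    expected number of occurrences of one clause [pattern b s] in its block. *)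
Lemma Pr_sat_le (n B h m : nat) (x := (m %/ 2 ^ k)%:R * (p t0 / (B * ('C(h, k) * 2 ^ k))%:R) : R) :
  n = (B * h)%N -> (forall t, fits B h (K t)) -> 0 < x ->
  Pr (mixture K p B h) (@sat n m) <=
    (1 + x) ^+ (2 ^ k) / (B%:R * x ^+ (2 ^ k) + (1 + x) ^+ (2 ^ k)).
Proof.
move=> nBh K_fits x0.
have k0 := k_gt0 K_type K_k; have kh := k_le_h K_fits K_k.
have h0 := h_gt0 K_type K_fits K_k; have B0 := B_gt0 K_fits K_k.
have cardS : #|{: {ffun 'I_k -> bool}}| = (2 ^ k)%N by rewrite card_ffun card_bool card_ord.
have d0 : (0 < m %/ 2 ^ k)%N.
  by rewrite lt0n; apply: contraTneq x0 => d0; rewrite /x d0 mul0r ltxx.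
rewrite PrE -cardS -[in B%:R](card_ord B).
apply: (@second_moment_bound R _ _ _ 'I_B _
  (fun s : {ffun 'I_k -> bool} => community m (m %/ 2 ^ k) (enum_rank s)) (@pattern n B h k)).
- by move=> c; apply: mixture_ge0.
- exact: (mixture_sum1 K_type p_sum1 nBh K_fits K_k).
- move=> s; apply: card_community => //.
  rewrite (leq_trans _ (leq_trunc_div m (2 ^ k))) // mulnC leq_mul2l -cardS.
  by rewrite ltn_ord orbT.
- by move=> s s' j js js'; apply/enum_rank_inj/val_inj/(community_disjoint js js').
- by move=> s b b'; apply: pattern_inj.
- by move=> b s; rewrite (mixtureE p K_type K_inj nBh K_fits K_k) // pattern_Omega.
- by rewrite card_ord.
- exact: x0.
move=> I Isat b; have [s sN] := @sat_pattern n B h k m I b Isat.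
by exists s => j _; apply: sN.
Qed.

(** Here [y] plays the role of [min(1, m/B)], and the constant depends only on [k] and [p t0]. *)
Lemma Pr_sat_upper : exists2 c : R, 0 < c & forall (n B h m : nat) (y : R),
  n = (B * h)%N -> (forall t, fits B h (K t)) ->
  0 < y <= 1 -> y * B%:R <= m%:R -> (2 ^ k <= m)%N ->
  Pr (mixture K p B h) (@sat n m) <= (1 + c * B%:R * (y / h%:R ^+ k) ^+ (2 ^ k))^-1.
Proof.
set L := (2 ^ k)%N; have L0 : (0 < L)%N by rewrite expn_gt0.
have LR : 0 < L%:R :> R by rewrite ltr0n.
have q1 : p t0 <= 1.
  by rewrite -p_sum1 (bigD1 t0) //= lerDl sumr_ge0 // => t _; apply: ltW.
(* One factor [2 * L] comes from [m <= 2 * L * (m %/ L)], the other [L] from the [2 ^ k] signs in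
   the size of [Omega]; thus [e * z <= x]. *)
pose e : R := p t0 / (2 * L%:R * L%:R).
have e0 : 0 < e by rewrite /e divr_gt0 ?p_gt0 ?mulr_gt0 ?ltr0n.
have e1 : e <= 1.
  rewrite ler_pdivrMr ?mulr_gt0 // mul1r (le_trans q1) //.
  by rewrite -!natrM ler1n !muln_gt0 L0.
have eE : p t0 = e * (2 * L%:R * L%:R) by rewrite /e divfK // gt_eqF ?mulr_gt0 ?ltr0n.
clearbody e; exists ((e / 2) ^+ L); first by apply/exprn_gt0/divr_gt0.
move=> n B h m y nBh K_fits /andP[y0 y1] yB Lm.
have k0 := k_gt0 K_type K_k; have kh := k_le_h K_fits K_k.
have h0 := h_gt0 K_type K_fits K_k; have B0 := B_gt0 K_fits K_k.
have hR : 1 <= h%:R ^+ k :> R by rewrite -natrX ler1n expn_gt0 h0.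
have hk0 : 0 < h%:R ^+ k :> R by apply: lt_le_trans hR.
have BR : 0 < B%:R :> R by rewrite ltr0n.
set z := y / h%:R ^+ k.
have z0 : 0 < z by apply: divr_gt0.
have z1 : z <= 1 by rewrite ler_pdivrMr // mul1r (le_trans y1).
have zE : y = z * h%:R ^+ k by rewrite /z divfK // gt_eqF.
clearbody z.
set x : R := (m %/ L)%:R * (p t0 / (B * ('C(h, k) * L))%:R).
have dm : m%:R <= 2 * L%:R * (m %/ L)%:R :> R.
  rewrite -!natrM ler_nat (leq_trans (ltnW (ltn_ceil m L0))) //.
  by rewrite mulSn -mulnA mul2n -addnn mulnC leq_add2r leq_pmulr // divn_gt0.
have C0 : (0 < 'C(h, k))%N by rewrite bin_gt0.
have CR : 0 < 'C(h, k)%:R :> R by rewrite ltr0n.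
have Ch : 'C(h, k)%:R <= h%:R ^+ k :> R by rewrite -natrX ler_nat bin_le_exp.
have xz : e * z <= x.
  have -> : x = ((m %/ L)%:R * p t0) / (B%:R * ('C(h, k)%:R * L%:R)).
    by rewrite /x !natrM mulrA.
  rewrite ler_pdivlMr; last by apply/mulr_gt0/mulr_gt0.
  have ezBL : 0 <= e * z * (B%:R * L%:R) by rewrite ltW // !mulr_gt0.
  have := ler_wpM2l ezBL Ch; have := ler_wpM2l (ltW e0) dm; have := ler_wpM2l (ltW e0) yB.
  have := ler_wpM2l (ltW LR); rewrite eE zE => LW h1 h2 h3.
  have := LW _ _ h1; have := LW _ _ h2; move: h3.
  by lra.
have ez0 : 0 < e * z by rewrite mulr_gt0.
have x0 : 0 < x by apply: lt_le_trans xz.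
apply: le_trans (Pr_sat_le nBh K_fits x0) _; rewrite -/L -/x.
have U0 : 0 < (1 + x) ^+ L by rewrite exprn_gt0 // addr_gt0.
have M0 : 0 < B%:R * x ^+ L by rewrite mulr_gt0 // exprn_gt0.
have -> : (1 + x) ^+ L / (B%:R * x ^+ L + (1 + x) ^+ L) = (1 + B%:R * (x / (1 + x)) ^+ L)^-1.
  by rewrite expr_div_n; field; rewrite !gt_eqF // addr_gt0.
have V0 : 0 < (e / 2) ^+ L * B%:R * z ^+ L.
  by apply/mulr_gt0/exprn_gt0/z0/mulr_gt0 => //; apply/exprn_gt0/divr_gt0.
rewrite lef_pV2 ?posrE ?addr_gt0 //; last first.
  by rewrite mulr_gt0 // exprn_gt0 // divr_gt0 // addr_gt0.
rewrite lerD2l mulrAC -exprMn mulrC ler_pM2l // lerXn2r ?nnegrE //.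
- by rewrite mulr_ge0 // ?ltW // divr_gt0.
- by rewrite ltW // divr_gt0 // addr_gt0.
(* Since [e * z] is at most both 1 and [x], [e * z * (1 + x) <= 2 * x]. *)
rewrite ler_pdivlMr ?addr_gt0 //.
have : e * z * x <= x by rewrite ler_piMl ?(ltW x0) // mulr_ile1 // ltW.
by lra.
Qed.

End SatUpper.

(** * Lower bounds on the probability of satisfiability *)

Section Occupancy.
Variables (R : realType) (J X C : finType) (mu : X -> R) (cell : C -> pred X) (r : nat).
Hypotheses (mu_ge0 : forall x, 0 <= mu x) (mu_sum1 : \sum_x mu x = 1).
Hypothesis cell_disj : forall b b' x, cell b x -> cell b' x -> b = b'.
Hypothesis cell_mu : forall b, \sum_x mu x * (cell b x)%:R = #|C|%:R^-1.
Hypothesis r_gt1 : (1 < r)%N.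
Hypothesis C_gt0 : (0 < #|C|)%N.

Local Notation E := (@expect R J X mu).
Local Notation beta := (#|C|%:R : R).

Definition load (D : {set J}) (b : C) (I : {ffun J -> X}) : nat :=
  #|[set j in D | cell b (I j)]%SET|.

Definition unsaturated (D : {set J}) (I : {ffun J -> X}) : bool :=
  [forall b, (load D b I < r)%N].

Let f D := E (fun I => (unsaturated D I)%:R).

Let beta_gt0 : 0 < beta. Proof. by rewrite ltr0n. Qed.

Let f_ge0 D : 0 <= f D. Proof. exact: expect_ge0. Qed.

Lemma unsaturated_local (D : {set J}) (I I' : {ffun J -> X}) :
  {in D, I =1 I'} -> unsaturated D I = unsaturated D I'.
Proof.
move=> II'; apply: eq_forallb => b; congr (_ < _)%N; apply: eq_card => j; rewrite !inE.
by case: (boolP (j \in D)) => //= /II' ->.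
Qed.

Lemma loadU1 i (D : {set J}) b I : i \notin D ->
  load (i |: D) b I = (cell b (I i) + load D b I)%N.
Proof.
move=> iD; rewrite /load; case: (boolP (cell b (I i))) => bi.
  have -> : [set j in i |: D | cell b (I j)]%SET = (i |: [set j in D | cell b (I j)])%SET.
    by apply/setP => j; rewrite !inE; case: (eqVneq j i) => [->|] //=; rewrite bi.
  by rewrite cardsU1 inE (negbTE iD).
rewrite add0n; apply: eq_card => j; rewrite !inE.
by case: (eqVneq j i) => [->|] //=; rewrite (negbTE bi) (negbTE iD).
Qed.

(** A new ball raises only the load of its own cell, and by one, so that cell already held [r.-1]
    balls. *)
Lemma saturated_by i (D : {set J}) I : i \notin D -> unsaturated D I ->
  ~~ unsaturated (i |: D) I -> exists2 b, cell b (I i) & (r.-1 <= load D b I)%N.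
Proof.
move=> iD /forallP DI /forallPn[b]; rewrite -leqNgt loadU1 //.
by have := DI b; case: (boolP (cell b (I i))) => bi; exists b => //; lia.
Qed.

(* The cell of a new ball differs with probability at least 1 - |D|/beta from
   those of the balls in D. *)
Let f_step i (D : {set J}) : i \notin D -> f D * (1 - #|D|%:R / beta) <= f (i |: D).
Proof.
move=> iD; pose g (b : C) j I : R := (unsaturated D I)%:R * (cell b (I j))%:R.
(* Since [r > 1], a cell saturated by ball [i] already contains some ball [j] of [D]; the double sum
   is the union bound over [j] and the cell. *)
have step : f D <= f (i |: D) + \sum_(j in D) \sum_b E (fun I => g b j I * (cell b (I i))%:R).
  under eq_bigr do rewrite -expect_sum.
  rewrite -expect_sum -expectD; apply: le_expect => // I.
  have G0 j b : 0 <= g b j I * (cell b (I i))%:R by rewrite !mulr_ge0.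
  have G0j j : 0 <= \sum_b g b j I * (cell b (I i))%:R by apply: sumr_ge0.
  have G00 : 0 <= \sum_(j in D) \sum_b g b j I * (cell b (I i))%:R by apply: sumr_ge0.
  case: (boolP (unsaturated D I)) => [DI|_]; last by rewrite addr_ge0.
  case: (boolP (unsaturated (i |: D) I)) => [_|]; first by rewrite lerDl.
  case/(saturated_by iD DI) => b bi Db.
  have /card_gt0P[j] : (0 < load D b I)%N by lia.
  rewrite inE => /andP[jD bj].
  rewrite add0r (bigD1 j) //= (bigD1 b) //= {1}/g DI bj bi !mulr1 -addrA lerDl addr_ge0 //.
    exact: sumr_ge0.
  exact: sumr_ge0.
have Eg j : j \in D -> \sum_b E (fun I => g b j I * (cell b (I i))%:R) <= f D / beta.
  move=> jD; rewrite (eq_bigr (fun b => E (g b j) / beta)) => [|b _]; last first.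
    rewrite (@expect_indep _ _ _ _ mu_sum1 (mem D) (g b j) (fun I => (cell b (I i))%:R)).
    - by rewrite (expect_coord mu_sum1 i (fun x => (cell b x)%:R)) cell_mu.
    - by move=> I I' II'; rewrite /g (unsaturated_local II') II'.
    - by move=> I I' II'; rewrite II' // inE.
  rewrite -mulr_suml ler_pM2r ?invr_gt0 // -expect_sum; apply: le_expect => // I.
  rewrite -mulr_sumr ler_piMr //.
  case: (pickP (fun b => cell b (I j))) => [b bj|no].
    rewrite (bigD1 b) //= bj big1 ?addr0 // => b' /eqP b'b.
    by case: (boolP (cell b' (I j))) => // b'j; case: b'b; apply: cell_disj b'j bj.
  by rewrite big1 // => b _; rewrite no.
rewrite mulrBr mulr1 lerBlDr (le_trans step) // lerD2l.
apply: le_trans (ler_sum _ Eg) _.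
by rewrite sumr_const -mulr_natl; lra.
Qed.

(** The balls of [S] are added one at a time; at most [#|C| / 2] balls are present, so by [f_step]
    each costs a factor at most 2. *)
Let f_double (S D : {set J}) : [disjoint S & D] -> (2 * #|S :|: D| <= #|C|)%N ->
  f D <= 2 ^+ #|S| * f (S :|: D).
Proof.
move En: #|S| => n; elim: n S En => [|n IHn] S Sn SD SC.
  by rewrite (cards0_eq Sn) finset.set0U mul1r.
have [i iS] : exists i, i \in S by apply/card_gt0P; rewrite Sn.
have SiD : (S :|: D = i |: (S :\ i :|: D))%SET by rewrite finset.setUA finset.setD1K.
have iN : i \notin (S :\ i :|: D)%SET.
  by rewrite !inE eqxx /= (disjointFr SD iS).
have iC : (2 * #|(S :\ i :|: D)%SET| <= #|C|)%N.
  by apply: leq_trans SC; rewrite SiD cardsU1 iN; lia.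
apply: (le_trans (IHn (S :\ i)%SET _ _ iC)).
- by move: (cardsD1 i S); rewrite iS Sn => -[].
- by apply: fintype.disjointWl SD; apply: finset.subD1set.
rewrite exprSr -mulrA ler_pM2l ?exprn_gt0 // SiD.
have := f_step iN; set g := f _; set g' := f _ => gg'.
have g0 : 0 <= g by apply: f_ge0.
have : #|(S :\ i :|: D)%SET|%:R / beta <= 2^-1.
  by rewrite ler_pdivrMr // mulrC ler_pdivlMr // -natrM ler_nat mulnC.
move=> /(ler_wpM2l g0) ?; lra.
Qed.

(** If ball [i] saturates a cell, some set [S] of [r.-1] balls of [D] shares the cell of [i]. That
    event is independent of the balls in [D :\: S] and has probability [beta^-1 ^+ r] for each cell.
    Then [f_double] returns from [D :\: S] to [D] at cost [2 ^+ r.-1], and there are at most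
    [#|D| ^ r.-1] choices of [S]. *)
Let f_hazard i (D : {set J}) : i \notin D -> (2 * #|D| <= #|C|)%N ->
  f D * (1 - (2 * #|D|%:R / beta) ^+ r.-1) <= f (i |: D).
Proof.
move=> iD DC; pose P := [set S : {set J} | (S \subset D) && (#|S| == r.-1)]%SET.
pose g (S : {set J}) b (I : {ffun J -> X}) : R := \prod_(j in i |: S) (cell b (I j))%:R.
have step : f D <= f (i |: D) + \sum_(S in P) \sum_b E (fun I => (unsaturated (D :\: S) I)%:R * g S b I).
  under eq_bigr do rewrite -expect_sum.
  rewrite -expect_sum -expectD; apply: le_expect => // I.
  have G0 S b : 0 <= (unsaturated (D :\: S) I)%:R * g S b I.
    by rewrite mulr_ge0 // prodr_ge0.
  have G00 : 0 <= \sum_(S in P) \sum_b (unsaturated (D :\: S) I)%:R * g S b I.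
    by apply: sumr_ge0 => S _; apply: sumr_ge0.
  case: (boolP (unsaturated D I)) => [DI|_]; last by rewrite addr_ge0.
  case: (boolP (unsaturated (i |: D) I)) => [_|]; first by rewrite lerDl.
  case/(saturated_by iD DI) => b bi Db.
  have [S SD Sr] : exists2 S : {set J}, (S \subset [set j in D | cell b (I j)]%SET) & (#|S| == r.-1).
    have : (0 < 'C(load D b I, r.-1))%N by rewrite bin_gt0.
    by rewrite -cards_draws => /card_gt0P[S]; rewrite inE => /andP[? ?]; exists S.
  have SP : S \in P.
    rewrite inE Sr andbT; apply: (fintype.subset_trans SD).
    by apply/fintype.subsetP => j; rewrite inE => /andP[].
  rewrite add0r (bigD1 S) //= (bigD1 b) //=.
  have -> : g S b I = 1.
    rewrite /g big1 // => j; rewrite !inE => /orP[/eqP ->|jS]; first by rewrite bi.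
    by move: (fintype.subsetP SD _ jS); rewrite inE => /andP[_ ->].
  have -> : unsaturated (D :\: S) I.
    apply/forallP => c; apply: leq_ltn_trans (forallP DI c); apply: subset_leq_card.
    by apply/fintype.subsetP => j; rewrite !inE => /andP[/andP[_ ->]].
  rewrite mulr1 -addrA lerDl addr_ge0 //; last by apply: sumr_ge0 => S' _; apply: sumr_ge0.
  by apply: sumr_ge0 => b' _; rewrite mulr_ge0 // prodr_ge0.
have ES S : S \in P -> \sum_b E (fun I => (unsaturated (D :\: S) I)%:R * g S b I) <=
    (2 / beta) ^+ r.-1 * f D.
  rewrite inE => /andP[SD /eqP Sr].
  have iS : i \notin S by apply: contra iD => /(fintype.subsetP SD).
  rewrite (eq_bigr (fun=> f (D :\: S) * beta^-1 ^+ r)) => [|b _]; last first.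
    rewrite (@expect_indep _ _ _ _ mu_sum1 (mem (D :\: S)) (fun I => (unsaturated (D :\: S) I)%:R) (g S b)).
    - rewrite (expect_prod mu_sum1 (mem (i |: S)) (fun _ x => (cell b x)%:R)).
      rewrite (eq_bigr (fun=> beta^-1)) => [|j _]; last by rewrite cell_mu.
      rewrite prodr_const; congr (_ * _ ^+ _); rewrite cardsU1 iS Sr; lia.
    - by move=> I I' II'; rewrite (unsaturated_local II').
    move=> I I' II'; apply: eq_bigr => j; rewrite !inE => jS; rewrite II' // !inE.
    by case/orP: jS => [/eqP ->|->] //; rewrite (negbTE iD) andbF.
  rewrite sumr_const -[X in X <= _]mulr_natl.
  have -> : beta * (f (D :\: S) * beta^-1 ^+ r) = beta^-1 ^+ r.-1 * f (D :\: S).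
    case: r r_gt1 => // r' _; rewrite exprS /=; field.
    by rewrite gt_eqF.
  rewrite exprMn mulrAC [X in X <= _]mulrC ler_wpM2r ?exprn_ge0 ?invr_ge0 ?(ltW beta_gt0) //.
  have SDD : (S :|: (D :\: S))%SET = D.
    by apply/setP => j; rewrite !inE; case: (boolP (j \in S)) => // /(fintype.subsetP SD) ->.
  rewrite -Sr -[in X in _ <= X]SDD; apply: f_double; rewrite ?SDD //.
  by rewrite finset.disjoints_subset; apply/fintype.subsetP => j jS; rewrite !inE jS.
rewrite mulrBr mulr1 lerBlDr (le_trans step) // lerD2l.
apply: le_trans (ler_sum _ ES) _; rewrite sumr_const -[X in X <= _]mulr_natl cards_draws mulrA [f D * _]mulrC.
rewrite ler_wpM2r // [_ * _%:R / _]mulrAC [X in _ <= X]exprMn mulrC.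
rewrite ler_wpM2l ?exprn_ge0 ?divr_ge0 ?(ltW beta_gt0) //.
by rewrite -natrX ler_nat bin_le_exp.
Qed.

(** The factors of [f_hazard] are multiplied over the balls, each weakened to its value at
    [#|J|]. *)
Lemma unsaturated_lower : (2 * #|J| <= #|C|)%N ->
  (1 - (2 * #|J|%:R / beta) ^+ r.-1) ^+ #|J| <= E (fun I => (unsaturated [set: J]%SET I)%:R).
Proof.
move=> JC; set y := (_ / _) ^+ _.
have q1 : 2 * #|J|%:R / beta <= 1 by rewrite ler_pdivrMr // mul1r -natrM ler_nat.
have q0 : 0 <= 2 * #|J|%:R / beta by rewrite divr_ge0 // ltW.
have y1 : 0 <= 1 - y by rewrite subr_ge0 exprn_ile1.
suff H n (D : {set J}) : #|D| = n -> (1 - y) ^+ n <= f D by rewrite -cardsT; apply: H.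
elim: n D => [|n IHn] D Dn.
  rewrite (cards0_eq Dn) /f -[X in X <= _](expect_cst J mu_sum1); apply: le_expect => // I.
  have -> // : unsaturated finset.set0 I.
  by apply/forallP => b; rewrite /load eq_card0 ?(ltnW r_gt1) // => j; rewrite !inE.
have [i iD] : exists i, i \in D by apply/card_gt0P; rewrite Dn.
have Di : #|(D :\ i)%SET| = n by move: (cardsD1 i D); rewrite iD Dn => -[].
have nJ : (n <= #|J|)%N by rewrite -Di max_card.
have qn : 0 <= 2 * n%:R / beta by rewrite divr_ge0 // ltW.
rewrite -(finset.setD1K iD); apply: le_trans (f_hazard _ _).
- rewrite exprSr ler_pM ?exprn_ge0 ?IHn // lerD2l lerN2 Di lerXn2r ?nnegrE //.
  by rewrite ler_pM2r ?invr_gt0 // ler_pM2l // ler_nat.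
- by rewrite !inE eqxx.
- by rewrite Di; lia.
Qed.

End Occupancy.

(** * Satisfiability when every community receives few clauses *)

(** A falsifying assignment has one choice at each variable of [c] and two elsewhere; the factor
    [2 ^ #|vars c|] on the left avoids a subtraction in the exponent. *)
Lemma card_falsifying (n : nat) (c : clause n) :
  (#|[set a : {ffun 'I_n -> bool} | ~~ satisfies a c]%SET| * 2 ^ #|vars c|)%N = (2 ^ n)%N.
Proof.
pose F (v : 'I_n) : pred bool := fun e => c v != Some e.
have -> : #|[set a : {ffun 'I_n -> bool} | ~~ satisfies a c]%SET| = #|family F|.
  apply: eq_card => a; rewrite inE; apply/existsPn/familyP => H v; exact: H.
rewrite card_family foldrE big_map big_enum /=.
rewrite (eq_bigr (fun v => if v \in vars c then 1 else 2)%N) => [|v _]; last first.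
  rewrite inE; case E : (c v) => [s|] /=.
    rewrite -(card1 (~~ s)); apply: eq_card => e; rewrite !inE /F unfold_in E.
    by case: s e {E} => -[].
  by rewrite -card_bool; apply: eq_card => e; rewrite !inE /F unfold_in E.
rewrite -prod_nat_const [X in (_ * X)%N]big_mkcond -big_split /=.
rewrite (eq_bigr (fun=> 2%N)) => [|v _]; last by case: ifP.
by rewrite prod_nat_const cardT size_enum_ord.
Qed.

(** Each clause excludes a fraction [2^-k] of the assignments, so fewer than [2 ^ k] clauses cannot
    exclude all. *)
Lemma few_clauses_sat (n m k : nat) (I : instance n m) (D : {set 'I_m}) :
  (#|D| < 2 ^ k)%N -> (forall i, i \in D -> #|vars (I i)| = k) ->
  exists a : {ffun 'I_n -> bool}, forall i, i \in D -> satisfies a (I i).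
Proof.
move=> Dk DI; apply: contrapT => /forallNP no.
pose N i := #|[set a : {ffun 'I_n -> bool} | ~~ satisfies a (I i)]%SET|.
suff : (2 ^ n * 2 ^ k <= #|D| * 2 ^ n)%N.
  by rewrite mulnC leq_pmul2r ?expn_gt0 // leqNgt Dk.
have -> : (#|D| * 2 ^ n = (\sum_(i in D) N i) * 2 ^ k)%N.
  rewrite -sum_nat_const big_distrl; apply: eq_bigr => i iD /=.
  by rewrite -(card_falsifying (I i)) DI.
rewrite leq_mul2r; apply/orP; right.
have -> : (2 ^ n = \sum_(a : {ffun 'I_n -> bool}) 1)%N.
  by rewrite sum1_card card_ffun card_bool card_ord.
have -> : (\sum_(i in D) N i = \sum_(a : {ffun 'I_n -> bool}) \sum_(i in D) ~~ satisfies a (I i))%N.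
  rewrite exchange_big; apply: eq_bigr => i _; rewrite /N -sum1_card big_mkcond.
  by apply: eq_bigr => a _; rewrite inE; case: (satisfies a _).
apply: leq_sum => a _.
have [i /not_implyP[iD /negP aN]] : exists i, ~ (i \in D -> satisfies a (I i)).
  by apply: contrapT => /forallNP H; apply: (no a) => i; apply: contrapT; apply: H.
by rewrite (bigD1 i) //= aN.
Qed.

Section SatLower.
Variables (n B h k m : nat).
Hypotheses (k_gt0 : (0 < k)%N) (kh : (k <= h)%N) (B_gt0 : (0 < B)%N) (nBh : n = (B * h)%N).

Local Notation cell b := (fun c : clause n => c \in kclauses k (community n h b)).

Lemma unsaturated_sat (I : instance n m) :
  (forall i, I i \in Omega n B h [:: k]) ->
  unsaturated (fun b : 'I_B => cell b) (2 ^ k) [set: 'I_m]%SET I -> sat I.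
Proof.
move=> IOm /forallP Iun.
have /fin_all_exists[a aP] (b : 'I_B) : exists a : {ffun 'I_n -> bool},
    forall i, i \in [set i in [set: 'I_m]%SET | cell b (I i)]%SET -> satisfies a (I i).
  by apply: few_clauses_sat (Iun b) _ => i; rewrite !inE /= => /andP[/eqP].
(* The assignments found for the separate communities are glued: each variable takes the value
   chosen by its own community. *)
apply/existsP; exists [ffun v : 'I_n => if insub (v %/ h)%N is Some b then a b v else false].
apply/forallP => i; have := IOm i; rewrite mem_Omega1 // => /existsP[b ib].
have /existsP[v /eqP vE] : satisfies (a b) (I i) by apply: aP; rewrite inE finset.in_setT.
have : v \in community n h b.
  move: ib; rewrite inE => /andP[_ /fintype.subsetP]; apply.
  by rewrite inE vE.
rewrite inE => /eqP vb; apply/existsP; exists v.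
by rewrite ffunE vb valK vE.
Qed.

(** [unsaturated_lower] with the clauses as balls, [r = 2 ^ k], and as cells the sets of clauses
    inside one community, each of mass [1 / B]. *)
Lemma Pr_unif_sat_lower (R : realType) : (2 * m <= B)%N ->
  (1 - (2 * m%:R / B%:R) ^+ (2 ^ k).-1) ^+ m <=
    Pr (unif R (Omega n B h [:: k])) (@sat n m).
Proof.
move=> mB; have h0 : (0 < h)%N by apply: leq_trans kh.
have Om0 : (0 < #|Omega n B h [:: k]|)%N.
  by rewrite card_Omega1 // !muln_gt0 B_gt0 bin_gt0 kh expn_gt0.
have U := @unsaturated_lower R 'I_m _ 'I_B (unif R (Omega n B h [:: k]))
  (fun b : 'I_B => cell b) (2 ^ k) (unif_ge0 _ _) (sum_unif1 R Om0).
apply: (@le_trans _ _ (expect (unif R (Omega n B h [:: k]))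
    (fun I => (unsaturated (fun b : 'I_B => cell b) (2 ^ k) [set: 'I_m]%SET I)%:R))).
  rewrite -[in _ * m%:R / B%:R](card_ord B) -[X in 2 * X%:R / _](card_ord m) -[X in _ ^+ X](card_ord m).
  apply: U; rewrite ?card_ord //.
  - by move=> b b' c cb cb'; apply/val_inj/(kclauses_disjoint k_gt0 cb cb').
  - move=> b; rewrite (eq_bigr (fun c => if cell b c then unif R (Omega n B h [:: k]) c else 0)); last first.
      by move=> c _; case: (cell b c); rewrite ?mulr1 ?mulr0.
    rewrite -big_mkcond /= sum_unif.
    have -> : (Omega n B h [:: k] :&: kclauses k (community n h b))%SET = kclauses k (community n h b).
      apply/finset.setIidPr/fintype.subsetP => c cb; rewrite mem_Omega1 //.
      by apply/existsP; exists b.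
    rewrite card_kclauses card_community //; last by rewrite nBh leq_mul2r ltn_ord orbT.
    rewrite card_Omega1 // natrM; field.
    by rewrite !pnatr_eq0 -!lt0n B_gt0 bin_gt0 kh expn_gt0.
  - by rewrite -[1%N](expn0 2) ltn_exp2l.
rewrite PrE; apply: le_expect_supp => [c|I IOm]; first exact: unif_ge0.
rewrite ler_nat; case: (boolP (unsaturated _ _ _ _)) => // /unsaturated_sat -> // i.
by have := IOm i; rewrite /unif; case: (_ \in _) => //; rewrite mul0r eqxx.
Qed.

End SatLower.

(** * Random k-SAT and the positivity of its threshold *)

Section RandomKSat.
Variables (R : realType) (k n : nat).

Local Notation Omk := [set c : clause n | #|vars c| == k]%SET.

Lemma card_kset : #|Omk| = ('C(n, k) * 2 ^ k)%N.
Proof.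
rewrite -[n in 'C(n, _)]card_ord -cardsT -card_kclauses; apply: eq_card => c.
by rewrite !inE finset.subsetT andbT.
Qed.

Hypothesis kn : (k <= n)%N.

Lemma kset_gt0 : (0 < #|Omk|)%N.
Proof. by rewrite card_kset muln_gt0 bin_gt0 kn expn_gt0. Qed.

(** Each set [W] of [k] variables carries the clause [g W] whose literals are all false under [a];
    hence at least ['C(n, k)] of the ['C(n, k) * 2 ^ k] clauses are falsified. *)
Lemma unif_satisfies_le (a : {ffun 'I_n -> bool}) :
  \sum_c unif R Omk c * (satisfies a c)%:R <= 1 - (2 ^+ k)^-1.
Proof.
pose N := [set c | ~~ satisfies a c]%SET.
have -> : \sum_c unif R Omk c * (satisfies a c)%:R = 1 - \sum_(c in N) unif R Omk c.
  rewrite -[X in _ = X - _](sum_unif1 R kset_gt0) [X in _ = _ - X]big_mkcond /= -sumrB.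
  apply: eq_bigr => c _; rewrite inE; case: (satisfies a c); rewrite ?mulr1 ?subr0 //.
  by rewrite mulr0 subrr.
rewrite lerD2l lerN2 sum_unif card_kset.
have C0 : 0 < 'C(n, k)%:R :> R by rewrite ltr0n bin_gt0.
have -> : (2 ^+ k)^-1 = 'C(n, k)%:R / ('C(n, k) * 2 ^ k)%:R :> R.
  by rewrite natrM natrX; field; rewrite gt_eqF // gt_eqF.
rewrite ler_pM2r ?invr_gt0 ?ltr0n -?card_kset ?kset_gt0 // ler_nat.
rewrite -[n in 'C(n, _)]card_ord -card_draws.
pose g (W : {set 'I_n}) : clause n := [ffun v => if v \in W then Some (~~ a v) else None].
have gE W : vars (g W) = W by apply/setP => v; rewrite inE ffunE; case: ifP.
rewrite -(card_imset _ (can_inj gE)); apply: subset_leq_card.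
apply/fintype.subsetP => _ /imsetP[W /[!inE] Wk ->]; rewrite gE Wk /=.
apply/existsPn => v; rewrite ffunE; case: ifP => // _; by case: (a v).
Qed.

(** First moment bound over the [2 ^ n] assignments. It shows that the set defining [rstar] is
    nonempty. *)
Lemma Pr_ksat_le (m : nat) :
  Pr (unif R Omk) (@sat n m) <= 2 ^+ n * (1 - (2 ^+ k)^-1) ^+ m.
Proof.
have mu1 := sum_unif1 R kset_gt0.
rewrite PrE; apply: (@le_trans _ _ (expect (unif R Omk) (fun I : instance n m =>
  \sum_(a : {ffun 'I_n -> bool}) \prod_(i in 'I_m) (satisfies a (I i))%:R))).
  apply: le_expect => [c|I]; first exact: unif_ge0.
  case: (boolP (sat I)) => [/existsP[a /forallP aI]|_]; last first.
    by apply: sumr_ge0 => a _; apply: prodr_ge0.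
  rewrite (bigD1 a) //= big1 => [|i _]; last by rewrite aI.
  by rewrite lerDl; apply: sumr_ge0 => a' _; apply: prodr_ge0.
rewrite expect_sum.
have -> : 2 ^+ n * (1 - (2 ^+ k)^-1) ^+ m = \sum_(a : {ffun 'I_n -> bool}) (1 - (2 ^+ k)^-1) ^+ m :> R.
  by rewrite sumr_const card_ffun card_bool card_ord -[RHS]mulr_natl natrX.
apply: ler_sum => a _.
rewrite (expect_prod mu1 (mem 'I_m) (fun _ c => (satisfies a c)%:R)) prodr_const card_ord.
rewrite lerXn2r ?nnegrE ?unif_satisfies_le //.
  by apply: sumr_ge0 => c _; rewrite mulr_ge0 ?unif_ge0.
by apply: le_trans (unif_satisfies_le [ffun=> true]); apply: sumr_ge0 => c _; rewrite mulr_ge0 ?unif_ge0.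
Qed.

End RandomKSat.

Definition covered (n m : nat) (I : instance n m) (S : {set 'I_m}) : {set 'I_n} :=
  [set v | [exists i in S, v \in vars (I i)]]%SET.

(* If S covers more than (k-1)|S| >= k|S|/2 variables then some variable occurs
   in a single clause of S; this clause can be satisfied last. *)
Lemma peeling (n m k : nat) (I : instance n m) : (1 < k)%N ->
  (forall i, #|vars (I i)| = k) ->
  (forall S : {set 'I_m}, (0 < #|S|)%N -> (k.-1 * #|S| < #|covered I S|)%N) -> sat I.
Proof.
move=> k1 Ik cov.
suff H s (S : {set 'I_m}) : #|S| = s ->
    exists a : {ffun 'I_n -> bool}, forall i, i \in S -> satisfies a (I i).
  have [a aI] := H _ [set: 'I_m]%SET erefl; apply/existsP; exists a; apply/forallP => i.
  by apply: aI; rewrite finset.in_setT.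
elim: s S => [|s IHs] S Ss.
  by exists [ffun=> true] => i; rewrite (cards0_eq Ss) finset.in_set0.
have S0 : (0 < #|S|)%N by rewrite Ss.
pose deg v := #|[set i in S | v \in vars (I i)]%SET|.
have degE : (\sum_v deg v = k * #|S|)%N.
  transitivity (\sum_v \sum_(i in S) (v \in vars (I i)))%N.
    apply: eq_bigr => v _; rewrite /deg -sum1_card.
    rewrite (eq_bigl (fun i => (i \in S) && (v \in vars (I i)))) => [|i]; last by rewrite inE.
    by rewrite big_mkcondr; apply: eq_bigr => i _; case: (v \in _).
  rewrite exchange_big /= mulnC -sum_nat_const; apply: eq_bigr => i _.
  by rewrite -(Ik i) -sum1_card [RHS]big_mkcond; apply: eq_bigr => v _; case: (v \in _).
have [v v1] : exists v, deg v = 1%N.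
  apply: contrapT => /forallNP no.
  have : (\sum_(v in covered I S) 2 <= \sum_v deg v)%N.
    rewrite big_mkcond; apply: leq_sum => v _; case: ifP => //.
    rewrite inE => /existsP[i /andP[iS vi]].
    have : (0 < deg v)%N by apply/card_gt0P; exists i; rewrite inE iS.
    by have := no v; lia.
  by rewrite degE sum_nat_const; have := cov S S0; nia.
have /cards1P[i iE] : #|[set i in S | v \in vars (I i)]%SET| == 1%N by apply/eqP.
have : i \in [set i in S | v \in vars (I i)]%SET by rewrite iE finset.in_set1.
rewrite inE => /andP[iS vi].
have [a aS] : exists a : {ffun 'I_n -> bool}, forall j, j \in (S :\ i)%SET -> satisfies a (I j).
  by apply: IHs; move: (cardsD1 i S); rewrite iS Ss => -[].
exists [ffun u => if u == v then odflt true (I i v) else a u] => j jS.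
case: (eqVneq j i) => [->|ji].
  apply/existsP; exists v; rewrite ffunE eqxx.
  by move: vi; rewrite inE; case: (I i v).
have vj : v \notin vars (I j).
  apply/negP => vj; move/negP: ji; apply; rewrite -finset.in_set1 -iE inE jS //.
have /existsP[u /eqP ju] : satisfies a (I j) by apply: aS; rewrite !inE ji.
apply/existsP; exists u; rewrite ffunE ju.
by case: (eqVneq u v) => // uv; move: vj; rewrite inE -uv ju.
Qed.

(** * Estimates for factorials, binomials and sums over sets *)

Lemma expR_nat_ge1 (R : realType) (v : nat) : 1 <= expR v%:R :> R.
Proof. by apply: le_trans (expR_ge1Dx _); rewrite lerDl. Qed.

(** Induction on [v], with [(1 + 1/v)^v <= e] for the step. *)
Lemma expn_self_le (R : realType) (v : nat) : v%:R ^+ v <= expR v%:R * v`!%:R :> R.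
Proof.
elim: v => [|v IHv]; first by rewrite expr0 expR0 mul1r.
case: (posnP v) IHv => [->|v0] IHv.
  by rewrite expr1 mulr1 (expR_nat_ge1 R 1).
have vR : 0 < v%:R :> R by rewrite ltr0n.
have H : (v.+1%:R / v%:R) ^+ v <= expR 1 :> R.
  apply: (@le_trans _ _ (expR v%:R^-1 ^+ v)).
    rewrite lerXn2r ?nnegrE ?expR_ge0 ?divr_ge0 //.
    by rewrite -addn1 natrD mulrDl divff ?gt_eqF // mul1r expR_ge1Dx.
  by rewrite -expRM_natl mulfV // gt_eqF.
have -> : v.+1%:R ^+ v.+1 = v.+1%:R * (v%:R ^+ v * (v.+1%:R / v%:R) ^+ v) :> R.
  by rewrite -exprMn mulrC exprS [in RHS]mulrC mulrCA divff ?gt_eqF // mulr1 mulrC.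
have -> : expR v.+1%:R * v.+1`!%:R = v.+1%:R * (expR v%:R * v`!%:R * expR 1) :> R.
  by rewrite -[in expR _]addn1 natrD expRD factS natrM; ring.
by rewrite ler_pM2l ?ltr0Sn // ler_pM ?exprn_ge0 ?divr_ge0.
Qed.

Lemma bin_exp_le (R : realType) (n v : nat) : (0 < n)%N ->
  'C(n, v)%:R * (v%:R / n%:R) ^+ v <= expR v%:R :> R.
Proof.
move=> n0; have nR : 0 < n%:R ^+ v :> R by rewrite exprn_gt0 ?ltr0n.
have fR : 0 < v`!%:R :> R by rewrite ltr0n fact_gt0.
rewrite -(ler_pM2r fR); apply: le_trans (expn_self_le R v).
rewrite expr_div_n mulrAC -natrM bin_ffact mulrA ler_pdivrMr // mulrC.
by rewrite ler_wpM2l ?exprn_ge0 // -natrX ler_nat ffact_le_exp.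
Qed.

(** Factor by factor, [(v - i) / (n - i) <= v / n]; the induction is on cross-multiplied falling
    factorials. *)
Lemma bin_ratio_le (R : realType) (n v k : nat) : (0 < n)%N -> (v <= n)%N -> (k <= n)%N ->
  'C(v, k)%:R / 'C(n, k)%:R <= (v%:R / n%:R) ^+ k :> R.
Proof.
move=> n0 vn kn.
have H : (v ^_ k * n ^ k <= n ^_ k * v ^ k)%N.
  elim: k {kn} => // k IHk; rewrite !ffactnSr !expnS.
  have -> : (v ^_ k * (v - k) * (n * n ^ k) = (v ^_ k * n ^ k) * ((v - k) * n))%N by ring.
  have -> : (n ^_ k * (n - k) * (v * v ^ k) = (n ^_ k * v ^ k) * ((n - k) * v))%N by ring.
  by rewrite leq_mul // !mulnBl [(n * v)%N]mulnC leq_sub2l // leq_mul2l vn orbT.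
have C0 : 0 < 'C(n, k)%:R :> R by rewrite ltr0n bin_gt0.
have nk : 0 < n%:R ^+ k :> R by rewrite exprn_gt0 ?ltr0n.
rewrite expr_div_n ler_pdivrMr // mulrAC ler_pdivlMr // -!natrX -!natrM ler_nat.
by rewrite -(leq_pmul2r (fact_gt0 k)) mulnAC bin_ffact -mulnA bin_ffact [X in (_ <= X)%N]mulnC.
Qed.

Lemma superset_card (T : finType) (A : {set T}) (v : nat) :
  (#|A| <= v <= #|T|)%N -> exists2 V : {set T}, A \subset V & #|V| == v.
Proof.
case/andP=> Av vT.
have : (0 < #|[set W : {set T} | W \subset ~: A & #|W| == v - #|A|]%SET|)%N.
  by rewrite cards_draws bin_gt0 [in X in (_ <= X)%N]cardsCs finset.setCK leq_sub2r.
case/card_gt0P => W; rewrite inE => /andP[WA /eqP Wv].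
exists (A :|: W)%SET; first exact: finset.subsetUl.
have AW : (A :&: W)%SET = finset.set0.
  by apply/finset.disjoint_setI0; rewrite disjoint_sym finset.disjoints_subset.
by rewrite cardsU AW cards0 subn0 Wv subnKC.
Qed.

Lemma sum_over_sets (R : realType) (m : nat) (g : nat -> R) :
  \sum_(S : {set 'I_m}) g #|S| = \sum_(s < m.+1) 'C(m, s)%:R * g s.
Proof.
have Sm (S : {set 'I_m}) : (#|S| < m.+1)%N by rewrite ltnS -[X in (_ <= X)%N]card_ord max_card.
rewrite (partition_big (fun S : {set 'I_m} => Ordinal (Sm S)) xpredT) //=.
apply: eq_bigr => s _; rewrite (eq_bigr (fun=> g s)) => [|S /eqP <- //].
rewrite sumr_const -[LHS]mulr_natl; congr (_%:R * _).
rewrite -[m in 'C(m, s)]card_ord -card_draws; apply: eq_card => S.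
by rewrite inE unfold_in.
Qed.

Lemma geometric_third_le (R : realType) (m : nat) : \sum_(s < m) 3^-1 ^+ s.+1 <= 2^-1 :> R.
Proof.
have -> : \sum_(s < m) 3^-1 ^+ s.+1 = 2^-1 - 2^-1 * 3^-1 ^+ m :> R.
  elim: m => [|m IHm]; first by rewrite big_ord0 expr0 mulr1 subrr.
  by rewrite big_ord_recr /= IHm exprS; field.
by rewrite gerBl mulr_ge0 ?exprn_ge0.
Qed.

Section SparseKSat.
Variables (R : realType) (k n m : nat).
Hypotheses (k_gt1 : (1 < k)%N) (kn : (k <= n)%N).
Hypothesis sparse : 3 * (k.-1%:R * expR k%:R) * m%:R <= n%:R :> R.

Local Notation Omk := [set c : clause n | #|vars c| == k]%SET.

Lemma unif_vars_sub (V : {set 'I_n}) :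
  \sum_c unif R Omk c * (vars c \subset V)%:R <= (#|V|%:R / n%:R) ^+ k.
Proof.
have n0 : (0 < n)%N by apply: leq_trans kn; apply: ltnW.
rewrite (eq_bigr (fun c => if c \in [set c : clause n | vars c \subset V]%SET then unif R Omk c else 0)); last first.
  by move=> c _; rewrite inE; case: (_ \subset _); rewrite ?mulr1 ?mulr0.
rewrite -big_mkcond /= sum_unif card_kset.
have -> : (Omk :&: [set c : clause n | vars c \subset V])%SET = kclauses k V.
  by apply/setP => c; rewrite !inE.
rewrite card_kclauses !natrM -mulf_div divff ?pnatr_eq0 ?expn_eq0 // mulr1.
by apply: bin_ratio_le => //; rewrite -[X in (_ <= X)%N]card_ord max_card.
Qed.

(** By [peeling], an unsatisfiable instance has [s > 0] clauses inside a set of [(k-1) s] variables.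
    The union bound over both sets gives at most [(e^k (k-1) m / n)^s] for each [s], which [sparse]
    makes at most [3^-s]; the geometric series sums to at most [1/2]. *)
Lemma Pr_ksat_unsat_le : Pr (unif R Omk) (@unsat n m) <= 2^-1.
Proof.
have n0 : (0 < n)%N by apply: leq_trans kn; apply: ltnW.
have mu1 := sum_unif1 R (kset_gt0 kn).
have k1 : 1 <= k.-1%:R :> R by rewrite ler1n; case: k k_gt1 => [|[]].
have ek : 1 <= expR k%:R :> R by apply: expR_nat_ge1.
have mn : (k.-1 * m <= n)%N.
  rewrite -(ler_nat R) natrM; apply: le_trans sparse.
  rewrite ler_wpM2r // -[X in X <= _]mul1r ler_pM ?ler1n //.
  by rewrite ler_peMr // (le_trans _ k1).
(* The value 0 at [s = 0] discards the empty set of clauses. *)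
pose g s : R := if (0 < s)%N then 'C(n, k.-1 * s)%:R * (((k.-1 * s)%:R / n%:R) ^+ k) ^+ s else 0.
apply: (@le_trans _ _ (\sum_(S : {set 'I_m}) g #|S|)).
  rewrite PrE; apply: (@le_trans _ _ (expect (unif R Omk) (fun I : instance n m =>
    \sum_(S : {set 'I_m} | (0 < #|S|)%N) \sum_(V : {set 'I_n} | #|V| == (k.-1 * #|S|)%N)
      \prod_(i in S) (vars (I i) \subset V)%:R))).
    apply: le_expect_supp => [c|I Isupp]; first exact: unif_ge0.
    have Ik i : #|vars (I i)| = k.
      have := Isupp i; rewrite /unif; case: (boolP (I i \in _)) => [|_]; last by rewrite mul0r eqxx.
      by rewrite inE => /eqP.
    have G00 (S : {set 'I_m}) (V : {set 'I_n}) : 0 <= \prod_(i in S) (vars (I i) \subset V)%:R :> R.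
      exact: prodr_ge0.
    have G0 (S : {set 'I_m}) (P : pred {set 'I_n}) : 0 <= \sum_(V : {set 'I_n} | P V) \prod_(i in S) (vars (I i) \subset V)%:R :> R.
      exact: sumr_ge0.
    case: (boolP (unsat I)) => [Iun|_]; last exact: sumr_ge0.
    have [S S0 Scov] : exists2 S : {set 'I_m}, (0 < #|S|)%N & (#|covered I S| <= k.-1 * #|S|)%N.
      apply: contrapT => no; move/negP: Iun; apply; apply: (peeling k_gt1 Ik) => S S0.
      by rewrite ltnNge; apply/negP => Sc; apply: no; exists S.
    have Sm : (#|S| <= m)%N by rewrite -[X in (_ <= X)%N]card_ord max_card.
    (* The covered variables are enlarged to exactly [k.-1 * #|S|], so the union bound runs over
       sets [V] of one size; [mn] guarantees enough variables. *)
    have [V SV Vc] : exists2 V : {set 'I_n}, covered I S \subset V & #|V| == (k.-1 * #|S|)%N.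
      apply: superset_card; rewrite Scov card_ord (leq_trans _ mn) //.
      by rewrite leq_mul2l Sm orbT.
    rewrite (bigD1 S) //= (bigD1 V) //= big1 => [|i iS].
      by rewrite -addrA lerDl addr_ge0 // sumr_ge0.
    suff -> : vars (I i) \subset V by [].
    apply: fintype.subset_trans SV; apply/fintype.subsetP => v vi; rewrite inE.
    by apply/existsP; exists i; rewrite iS.
  rewrite expect_sum big_mkcond; apply: ler_sum => S _; rewrite /g; case: ifP => // S0.
  rewrite expect_sum.
  apply: (@le_trans _ _ (\sum_(V : {set 'I_n} | #|V| == (k.-1 * #|S|)%N)
    (((k.-1 * #|S|)%:R / n%:R) ^+ k) ^+ #|S|)).
    apply: ler_sum => V /eqP Vc.
    rewrite (expect_prod mu1 (mem S) (fun _ c => (vars c \subset V)%:R)) prodr_const.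
    rewrite lerXn2r ?nnegrE -?Vc ?unif_vars_sub ?exprn_ge0 ?divr_ge0 //.
    by apply: sumr_ge0 => c _; rewrite mulr_ge0 ?unif_ge0.
  rewrite sumr_const -[X in X <= _]mulr_natl -cardsE card_draws card_ord.
  exact: lexx.
rewrite sum_over_sets big_ord_recl /= /g /= mulr0 add0r.
apply: le_trans (geometric_third_le R m); apply: ler_sum => i _ /=; rewrite /bump /= add1n.
have m0 : (0 < m)%N by apply: leq_ltn_trans (ltn_ord i).
set s := i.+1; set v := (k.-1 * s)%N.
have nR : 0 < n%:R :> R by rewrite ltr0n.
have mR : 0 < m%:R :> R by rewrite ltr0n.
(* Of the [k * s] factors [v / n], [v] are kept to offset ['C(n, v)]; the other [s] are split so
   that [(s / m) ^+ s] offsets ['C(m, s)]. *)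
have -> : ((v%:R / n%:R) ^+ k) ^+ s = (v%:R / n%:R) ^+ v * ((s%:R / m%:R) ^+ s * (k.-1%:R * m%:R / n%:R) ^+ s) :> R.
  rewrite -exprMn -exprM.
  have -> : s%:R / m%:R * (k.-1%:R * m%:R / n%:R) = v%:R / n%:R :> R.
    by rewrite /v natrM; field; rewrite !gt_eqF.
  by rewrite -exprD /v; congr (_ ^+ _); have := k_gt1; nia.
rewrite [X in X <= _](_ : _ = ('C(m, s)%:R * (s%:R / m%:R) ^+ s) * ('C(n, v)%:R * (v%:R / n%:R) ^+ v) * (k.-1%:R * m%:R / n%:R) ^+ s); last by ring.
have q0 : 0 <= k.-1%:R * m%:R / n%:R :> R by rewrite divr_ge0 ?mulr_ge0.
apply: (@le_trans _ _ (expR s%:R * expR v%:R * (k.-1%:R * m%:R / n%:R) ^+ s)).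
  apply: ler_wpM2r; first exact: exprn_ge0.
  by apply: ler_pM; rewrite ?bin_exp_le // mulr_ge0 ?exprn_ge0 ?divr_ge0.
have -> : expR s%:R * expR v%:R = expR k%:R ^+ s :> R.
  rewrite -expRD -natrD -expRM_natl -natrM; congr (expR _%:R).
  by rewrite /v; have := k_gt1; nia.
rewrite -exprMn lerXn2r ?nnegrE ?mulr_ge0 ?expR_ge0 ?invr_ge0 //.
rewrite mulrA ler_pdivrMr // ler_pdivlMl //.
by apply: le_trans sparse; lra.
Qed.

End SparseKSat.

Lemma alongP (N : set nat) (P : nat -> Prop) :
  (\forall n \near within N \oo%classic, P n) <->
  exists M, forall n, (M <= n)%N -> N n -> P n.
Proof.
split => [[M _ MP]|[M MP]]; first by exists M.
by exists M.
Qed.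

Lemma along_cvg1 (R : realType) (N : set nat) (f : nat -> R) :
  (forall e : R, 0 < e -> exists M, forall n, (M <= n)%N -> N n -> 1 - e <= f n <= 1) ->
  (f @ within N \oo --> (1 : R))%classic.
Proof.
move=> H; apply/cvgrPdist_le => e e0; apply/alongP.
have [M MH] := H e e0; exists M => n Mn Nn; have /andP[fe f1] := MH n Mn Nn.
by rewrite ger0_norm ?subr_ge0 //; lra.
Qed.

(** [a0] is a lower bound of the set defining [rstar], by [Pr_ksat_unsat_le]. Nonemptiness must be
    shown too, since [inf] of the empty set is 0. *)
Lemma rstar_gt0 (R : realType) (k : nat) : (1 < k)%N -> 0 < rstar R k.
Proof.
move=> k1.
pose a0 : R := (3 * (k.-1%:R * expR k%:R))^-1.
have k1R : 0 < k.-1%:R :> R by rewrite ltr0n; case: k k1 {a0} => [|[]].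
have a00 : 0 < a0 by rewrite invr_gt0 !mulr_gt0 ?expR_gt0.
apply: (lt_le_trans a00); apply: lb_le_inf.
  (* At this density the first moment is at most [(2 e^-2)^n <= e^-n <= 1 / (1 + n)]. *)
  exists (2 * 2 ^ k)%:R; split=> //.
  pose G (n : nat) := Num.truncn ((2 * 2 ^ k)%:R * n%:R : R).
  have GE n : G n = (2 * 2 ^ k * n)%N by rewrite /G -natrM Num.Theory.natrK.
  have key n : (k <= n)%N -> pr_ksat R k (G n) sat n <= (1 + n%:R)^-1.
    move=> kn; apply: le_trans (Pr_ksat_le R kn _) _.
    have q0 : 0 <= 1 - (2 ^+ k)^-1 :> R.
      by rewrite subr_ge0 invf_le1 ?exprn_gt0 // exprn_ege1 // ler1n.
    have qe : (1 - (2 ^+ k)^-1) ^+ (2 ^ k) <= (expR 1)^-1 :> R.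
      apply: (@le_trans _ _ (expR (- (2 ^+ k)^-1) ^+ (2 ^ k))).
        by rewrite lerXn2r ?nnegrE ?expR_ge0 ?expR_ge1Dx.
      by rewrite -expRM_natl natrX mulrN divff ?expRN // expf_neq0.
    have e2 : 2 <= expR 1 :> R by apply: le_trans (expR_ge1Dx _).
    rewrite GE; apply: (@le_trans _ _ ((expR 1)^-1 ^+ n)).
      rewrite mulnAC mulnC exprM exprM -exprMn lerXn2r ?nnegrE ?invr_ge0 ?expR_ge0 //.
        by rewrite mulr_ge0 ?exprn_ge0.
      apply: (@le_trans _ _ (expR 1 * ((expR 1)^-1 ^+ 2))).
        by rewrite ler_pM ?exprn_ge0 // lerXn2r ?nnegrE ?exprn_ge0 ?invr_ge0 ?expR_ge0.
      by rewrite expr2 mulrA divff ?mul1r // gt_eqF ?expR_gt0.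
    by rewrite exprVn -expRM_natl mulr1 lef_pV2 ?posrE ?expR_gt0 ?expR_ge1Dx // ltr_wpDr.
  apply/cvgrPdist_le => e e0.
  exists (maxn k (Num.truncn e^-1).+1) => // n /=; rewrite geq_max => /andP[kn en].
  have mu1 := sum_unif1 R (kset_gt0 kn).
  have s0 : 0 <= pr_ksat R k (G n) sat n.
    by rewrite /pr_ksat PrE; apply: expect_ge0 => // c; apply: unif_ge0.
  rewrite /pr_ksat (Pr_unsat _ mu1) opprB addrC subrK ger0_norm //.
  apply: le_trans (key n kn) _; rewrite -[e]invrK lef_pV2 ?posrE ?invr_gt0 ?ltr_wpDr //.
  apply: le_trans (_ : n%:R <= _); last by rewrite lerDr.
  apply: ltW; apply: lt_le_trans (truncnS_gt _) _; by rewrite ler_nat.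
(* For [a < a0] the hypothesis [sparse] holds with [a n] clauses, so the probability of
   unsatisfiability stays at most [1/2], contradicting convergence to 1. *)
move=> a [a_ge0 /cvgrPdist_lt /(_ 2^-1)]; rewrite invr_gt0 ltr0n => /(_ isT)[M _ MP].
rewrite leNgt; apply/negP => aa0.
pose n := maxn k M; have kn : (k <= n)%N by apply: leq_maxl.
have := MP n (leq_maxr _ _); rewrite /pr_ksat => H.
have : Pr (unif R [set c : clause n | #|vars c| == k]%SET) (@unsat n (Num.truncn (a * n%:R))) <= 2^-1.
  apply: Pr_ksat_unsat_le => //.
  apply: (@le_trans _ _ (a0^-1 * (a * n%:R))).
    by rewrite /a0 invrK ler_pM2l ?mulr_gt0 ?expR_gt0 // Num.Theory.truncn_le mulr_ge0.
  by rewrite mulrA ler_piMl // ler_pdivrMl // mulr1 ltW.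
by move: H; rewrite ltr_norml => /andP[_]; lra.
Qed.

(** * Asymptotics *)

Lemma powR_eventually_ge (R : realType) (a A : R) : 0 < a ->
  exists M, forall n, (M <= n)%N -> A <= n%:R `^ a.
Proof.
move=> a0; pose A' := Num.max A 1.
have A'1 : 1 <= A' by rewrite le_max lexx orbT.
exists (Num.truncn (A' `^ a^-1)).+1 => n nM.
have nA : A' `^ a^-1 <= n%:R.
  by apply: ltW; apply: lt_le_trans (Num.Theory.truncnS_gt _) _; rewrite ler_nat.
apply: (@le_trans _ _ A'); first by rewrite le_max lexx.
have A'0 : 0 <= A' by apply: le_trans A'1.
rewrite -[X in X <= _](powRr1 A'0) -[X in _ `^ X](mulVf (lt0r_neq0 a0)) powRrM.
by apply: ge0_ler_powR; rewrite ?nnegrE ?powR_ge0 ?ler0n ?(ltW a0).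
Qed.

(** [ln (n^s) < n^s] bounds [ln n] by [n^s / s]; with [s = a / (j + 1)], also defined for [j = 0],
    the [j]-th power stays below [n^a] up to a constant. *)
Lemma ln_exp_le_powR (R : realType) (j : nat) (a : R) : 0 < a ->
  exists2 D : R, 0 < D & forall n, (0 < n)%N -> ln n%:R ^+ j <= D * n%:R `^ a.
Proof.
move=> a0; pose s := a / j.+1%:R; have s0 : 0 < s by rewrite divr_gt0.
exists (s^-1 ^+ j); first by rewrite exprn_gt0 ?invr_gt0.
move=> n n0; have n1 : 1 <= n%:R :> R by rewrite ler1n.
have ln0 : 0 <= ln n%:R :> R by apply: ln_ge0.
have ps : 0 < n%:R `^ s by apply: powR_gt0; rewrite ltr0n.
have le1 : ln n%:R <= s^-1 * n%:R `^ s.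
  by rewrite ler_pdivlMl // -ln_powR ltW // ln_sublinear.
apply: (@le_trans _ _ ((s^-1 * n%:R `^ s) ^+ j)).
  by rewrite lerXn2r ?nnegrE ?mulr_ge0 ?invr_ge0 // ltW.
rewrite exprMn ler_wpM2l ?exprn_ge0 ?invr_ge0 ?(ltW s0) //.
rewrite -powR_mulrn ?(ltW ps) // -powRrM ler_powR // /s.
by rewrite -mulrA ler_piMr ?(ltW a0) // ler_pdivrMl // mulr1 ler_nat.
Qed.

Section Asymptotics.
Variables (R : realType) (T : nat) (K : 'I_T -> seq nat) (p : 'I_T -> R) (k : nat).
Variables (N : set nat) (B h : nat -> nat).
Hypotheses (K_type : forall t, is_clause_type (K t)) (K_inj : injective K)
  (p_gt0 : forall t, 0 < p t) (p_sum1 : \sum_t p t = 1).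
Hypotheses (N_split : forall n, N n -> n = (B n * h n)%N)
  (K_fits : forall n t, N n -> fits (B n) (h n) (K t)).
Variable t0 : 'I_T.
Hypothesis K_k : K t0 = [:: k].

Local Notation L := (2 ^ k)%N.

Let k_gt0 : (0 < k)%N. Proof. exact: (k_gt0 K_type K_k). Qed.

Let h_gt0 n : N n -> (0 < h n)%N.
Proof. by move=> Nn; apply: (h_gt0 K_type (fun t => K_fits t Nn) K_k). Qed.

Let B_gt0 n : N n -> (0 < B n)%N.
Proof. by move=> Nn; apply: (B_gt0 (fun t => K_fits t Nn) K_k). Qed.

Let n_gt0 n : N n -> (0 < n)%N.
Proof. by move=> Nn; rewrite (N_split Nn) muln_gt0 B_gt0 ?h_gt0. Qed.

Let L_gt0 : 0 < L%:R :> R. Proof. by rewrite ltr0n expn_gt0. Qed.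

Let L_ge2 : 2 <= L%:R :> R.
Proof. by rewrite ler_nat -[2%N in X in (X <= _)%N]expn1 leq_exp2l. Qed.

Let mixture_total n : N n -> \sum_(c : clause n) mixture K p (B n) (h n) c = 1.
Proof.
by move=> Nn; apply: (mixture_sum1 K_type p_sum1 (N_split Nn) (fun t => K_fits t Nn) K_k).
Qed.

Lemma prF_sat_ge0 m n : 0 <= prF K p B h m sat n.
Proof. by rewrite /prF PrE; apply: expect_ge0 => // c; apply: mixture_ge0. Qed.

Lemma prF_sat_le1 m n : N n -> prF K p B h m sat n <= 1.
Proof.
move=> Nn; rewrite /prF PrE -[X in _ <= X](expect_cst 'I_(m n) (mixture_total Nn)).
by apply: le_expect => [c|I]; [apply: mixture_ge0 | rewrite -[1]/(1%:R) ler_nat leq_b1].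
Qed.

Lemma prF_unsat m n : N n -> prF K p B h m unsat n = 1 - prF K p B h m sat n.
Proof. by move=> Nn; apply: Pr_unsat; apply: mixture_total. Qed.

Lemma prF_unsat_cvg1 m (g : nat -> R) :
  (exists M, forall n, (M <= n)%N -> N n -> prF K p B h m sat n <= (1 + g n)^-1) ->
  (forall A : R, exists M, forall n, (M <= n)%N -> N n -> A <= g n) ->
  (prF K p B h m unsat @ within N \oo --> (1 : R))%classic.
Proof.
move=> [M1 H1] H2; apply: along_cvg1 => e e0; have [M2 H2'] := H2 e^-1.
exists (maxn M1 M2) => n; rewrite geq_max => /andP[n1 n2] Nn.
rewrite prF_unsat // gerBl prF_sat_ge0 andbT lerD2l lerN2.
apply: le_trans (H1 n n1 Nn) _; have ge := H2' n n2 Nn.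
have ei : 0 < e^-1 by rewrite invr_gt0.
by rewrite -[e]invrK lef_pV2 ?posrE //; lra.
Qed.

(** [Pr_sat_upper] at [y = A n^(-a/L)], with [B = n / h] substituted; the condition [y B <= m]
    follows from [B <= n]. The case [a = 1] is the threshold scale of (a), while [a < 1] leaves a
    positive power of [n]. *)
Lemma sat_upper_powR : exists2 c : R, 0 < c & forall (m : nat -> nat) (A a : R) (n : nat),
  N n -> 0 < A -> A * n%:R `^ (- (a / L%:R)) <= 1 -> A * n%:R `^ (1 - a / L%:R) <= (m n)%:R ->
  (L <= m n)%N ->
  prF K p B h m sat n <= (1 + c * A ^+ L * n%:R `^ (1 - a) / (h n)%:R ^+ (k * L).+1)^-1.
Proof.
have [c c0 H] := Pr_sat_upper K_type K_inj p_gt0 p_sum1 K_k.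
exists c => // m A a n Nn A0 y1 Am Lm.
have nR : 0 < n%:R :> R by rewrite ltr0n n_gt0.
have hR : 0 < (h n)%:R :> R by rewrite ltr0n h_gt0.
have nBh : n%:R = (B n)%:R * (h n)%:R :> R by rewrite -natrM -N_split.
have nn0 : n%:R != 0 :> R by rewrite gt_eqF.
have pw : n%:R `^ (1 - a / L%:R) = n%:R * n%:R `^ (- (a / L%:R)) :> R.
  by rewrite powRD ?nn0 ?implybT // powRr1 // ltW.
have pw' : n%:R `^ (1 - a) = n%:R * (n%:R `^ (- (a / L%:R))) ^+ L :> R.
  rewrite -powR_mulrn ?powR_ge0 // -powRrM mulNr divfK ?gt_eqF // powRD ?nn0 ?implybT //.
  by rewrite powRr1 // ltW.
have w0 : 0 < n%:R `^ (- (a / L%:R)) :> R by apply: powR_gt0.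
move: pw pw' w0 y1; set w := n%:R `^ (- _) => pw pw' w0 y1.
have yB : A * w * (B n)%:R <= (m n)%:R.
  apply: le_trans Am; rewrite pw nBh.
  have -> : A * ((B n)%:R * (h n)%:R * w) = A * w * (B n)%:R * (h n)%:R by ring.
  by rewrite ler_peMr ?ler1n ?h_gt0 // !mulr_ge0 // ltW.
have := H n (B n) (h n) (m n) (A * w) (N_split Nn) (fun t => K_fits t Nn) _ yB Lm.
rewrite y1 mulr_gt0 // => /(_ isT); rewrite -/(prF K p B h m sat n).
congr (_ <= (1 + _)^-1); rewrite pw' nBh expr_div_n -exprM exprMn exprS.
have h_neq0 : (h n)%:R != 0 :> R by rewrite gt_eqF.
by field; rewrite expf_neq0.
Qed.

Lemma powR_monomial_le1 (A a : R) : 0 < a ->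
  exists M, forall n, (M <= n)%N -> N n -> A * n%:R `^ (- a) <= 1.
Proof.
move=> a0; have [M MH] := powR_eventually_ge A a0; exists M => n Mn Nn.
by rewrite powRN ler_pdivrMr ?mul1r ?MH // powR_gt0 // ltr0n n_gt0.
Qed.

(** The exponent [1 - a / L] is positive because [a <= 1 < L]. The conclusion makes the blocks of
    [m %/ L] clauses nonempty. *)
Lemma many_clauses (A a : R) (m : nat -> nat) : 0 < A -> a <= 1 ->
  (exists M, forall n, (M <= n)%N -> N n -> A * n%:R `^ (1 - a / L%:R) <= (m n)%:R) ->
  exists M, forall n, (M <= n)%N -> N n -> (L <= m n)%N.
Proof.
move=> A0 a1 [M1 H1].
have e0 : 0 < 1 - a / L%:R.
  by rewrite subr_gt0 ltr_pdivrMr // mul1r; have := L_ge2; lra.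
have [M2 H2] := powR_eventually_ge (A^-1 * L%:R) e0.
exists (maxn M1 M2) => n; rewrite geq_max => /andP[n1 n2] Nn.
rewrite -(ler_nat R); apply: le_trans (H1 n n1 Nn).
by rewrite -ler_pdivrMl // H2.
Qed.

(** The case [a = 1]. The constant [c] is chosen before [m] and [A], so [A] may later be taken
    large. *)
Lemma sat_upper_bounded (H : R) : 0 < H ->
  (exists M, forall n, (M <= n)%N -> N n -> (h n)%:R <= H) ->
  exists2 c : R, 0 < c & forall (m : nat -> nat) (A : R), 0 < A ->
  (exists M, forall n, (M <= n)%N -> N n -> A * n%:R `^ (1 - 1 / L%:R) <= (m n)%:R) ->
  exists M, forall n, (M <= n)%N -> N n -> prF K p B h m sat n <= (1 + c * A ^+ L)^-1.
Proof.
move=> H0 [M1 hH]; have [c c0 cH] := sat_upper_powR.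
exists (c / H ^+ (k * L).+1); first by rewrite divr_gt0 // exprn_gt0.
move=> m A A0 Am; have [M2 Am'] := Am.
have [M3 H3] := many_clauses A0 (lexx 1) Am.
have [M4 H4] := @powR_monomial_le1 A (1 / L%:R) (divr_gt0 ltr01 L_gt0).
exists (maxn (maxn M1 M2) (maxn M3 M4)) => n.
rewrite !geq_max => /andP[/andP[n1 n2] /andP[n3 n4]] Nn.
apply: le_trans (cH m A 1 n Nn A0 (H4 n n4 Nn) (Am' n n2 Nn) (H3 n n3 Nn)) _.
have hR : 0 < (h n)%:R :> R by rewrite ltr0n h_gt0.
have cA : 0 < c * A ^+ L by rewrite mulr_gt0 // exprn_gt0.
rewrite subrr powRr0 mulr1 lef_pV2 ?posrE; last 2 first.
- by rewrite ltr_wpDr // ltW // divr_gt0 // exprn_gt0.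
- by rewrite ltr_wpDr // ltW // mulr_gt0 ?exprn_gt0 // divr_gt0 // exprn_gt0.
rewrite lerD2l mulrAC ler_pM2l // lef_pV2 ?posrE ?exprn_gt0 //.
by rewrite lerXn2r ?nnegrE ?(ltW H0) ?hH.
Qed.

(** Common source of (b), (c) and (d): with [a = 1 - d] the bound of [sat_upper_powR] has [n^d] over
    a power of [ln n], which tends to infinity. *)
Lemma unsat_of_polylog (Ch A d : R) (m : nat -> nat) : 0 < Ch -> 0 < A -> 0 < d -> d <= 1 ->
  (exists M, forall n, (M <= n)%N -> N n -> (h n)%:R <= Ch * ln n%:R) ->
  (exists M, forall n, (M <= n)%N -> N n -> A * n%:R `^ (1 - (1 - d) / L%:R) <= (m n)%:R) ->
  (prF K p B h m unsat @ within N \oo --> (1 : R))%classic.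
Proof.
move=> Ch0 A0 d0 d1 [M1 hH] [M2 Am]; have [c c0 cH] := sat_upper_powR.
(* With [A1 <= 1] the requirement [y <= 1] holds for every admissible [n]. *)
pose A1 := Num.min A 1.
have A10 : 0 < A1 by rewrite lt_min A0 ltr01.
have A1m : exists M, forall n, (M <= n)%N -> N n -> A1 * n%:R `^ (1 - (1 - d) / L%:R) <= (m n)%:R.
  exists M2 => n n2 Nn; apply: le_trans (Am n n2 Nn).
  by rewrite ler_wpM2r ?powR_ge0 // ge_min lexx.
pose g n : R := c * A1 ^+ L * n%:R `^ (1 - (1 - d)) / (h n)%:R ^+ (k * L).+1.
apply: (@prF_unsat_cvg1 m g).
  have [M4 H4] := A1m.
  have d1' : 1 - d <= 1 by rewrite gerBl ltW.
  have [M3 H3] := many_clauses A10 d1' A1m.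
  exists (maxn M3 M4) => n; rewrite geq_max => /andP[n3 n4] Nn.
  apply: cH => //; [ | exact: H4 | exact: H3].
  rewrite mulr_ile1 ?powR_ge0 ?(ltW A10) ?ge_min ?lexx ?orbT //.
  have n1 : 1 <= n%:R :> R by rewrite ler1n n_gt0.
  rewrite -[X in _ <= X](powRr0 n%:R) ler_powR // oppr_le0 divr_ge0 ?subr_ge0 // ltW.
(* Half of [n^d] absorbs the power of [ln n], the other half exceeds any bound [X]. *)
move=> X; have d2 : 0 < d / 2 by rewrite divr_gt0.
have [D D0 DH] := ln_exp_le_powR (k * L).+1 d2.
pose c1 := c * A1 ^+ L / (Ch ^+ (k * L).+1 * D).
have c10 : 0 < c1 by rewrite divr_gt0 ?mulr_gt0 ?exprn_gt0.
have [M3 H3] := powR_eventually_ge (c1^-1 * X) d2.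
exists (maxn M1 M3) => n; rewrite geq_max => /andP[n1 n3] Nn.
have nR : 0 < n%:R :> R by rewrite ltr0n n_gt0.
have hR : 0 < (h n)%:R :> R by rewrite ltr0n h_gt0.
have Xn : X <= c1 * n%:R `^ (d / 2) by rewrite -ler_pdivrMl // H3.
apply: le_trans Xn _; rewrite /g ler_pdivlMr ?exprn_gt0 // subKr.
have p0 : 0 < n%:R `^ (d / 2) :> R by apply: powR_gt0.
have -> : n%:R `^ d = n%:R `^ (d / 2) * n%:R `^ (d / 2) :> R.
  by rewrite -powRD -?splitr // gt_eqF ?implybT.
have hD : (h n)%:R ^+ (k * L).+1 <= Ch ^+ (k * L).+1 * (D * n%:R `^ (d / 2)).
  apply: (@le_trans _ _ ((Ch * ln n%:R) ^+ (k * L).+1)).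
    by rewrite lerXn2r ?nnegrE ?hH // (le_trans (ltW hR)) // hH.
  by rewrite exprMn ler_wpM2l ?exprn_ge0 ?(ltW Ch0) // DH // n_gt0.
apply: le_trans (ler_wpM2l _ hD) _; first by rewrite mulr_ge0 // ltW.
rewrite le_eqVlt; apply/orP; left; apply/eqP; rewrite /c1.
have Dn0 : D != 0 by rewrite gt_eqF.
have Cn0 : Ch ^+ (k * L).+1 != 0 by rewrite expf_neq0 // gt_eqF.
by field; rewrite Dn0.
Qed.

End Asymptotics.

(** On [[0, 1/2]], [1 <= (1 - y) (1 + 2 y) <= (1 - y) e^(2 y)]. *)
Lemma expR_le_1sub (R : realType) (y : R) : 0 <= y -> y <= 2^-1 -> expR (- (2 * y)) <= 1 - y.
Proof.
move=> y0 y1; rewrite expRN -(ler_pM2r (expR_gt0 (2 * y))) mulVf ?gt_eqF ?expR_gt0 //.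
apply: (@le_trans _ _ ((1 - y) * (1 + 2 * y))).
  have := ler_wpM2l y0 y1; lra.
by rewrite ler_wpM2l ?expR_ge1Dx //; lra.
Qed.

Section AsymptoticsSat.
Variables (R : realType) (T : nat) (K : 'I_T -> seq nat) (p : 'I_T -> R) (k : nat).
Variables (N : set nat) (B h : nat -> nat).
Hypotheses (K_type : forall t, is_clause_type (K t)) (p_sum1 : \sum_t p t = 1).
Hypotheses (N_split : forall n, N n -> n = (B n * h n)%N)
  (K_fits : forall n t, N n -> fits (B n) (h n) (K t)).
Variable t0 : 'I_T.
Hypothesis K_k : K t0 = [:: k].
Hypothesis T1 : T = 1%N.

Local Notation L := (2 ^ k)%N.

(** In [(1 - y)^m] with [y = (2m/B)^(L-1)], the bounds [B >= n / H] and [m <= A n^(1-1/L)] give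
    [m y <= (2H)^(L-1) A^L], because [n^(L-1)] is the [L]-th power of [n^(1-1/L)]. [G] is twice the
    constant, for [expR_le_1sub], and does not depend on [A]. *)
Lemma sat_lower_bounded (H : R) : 0 < H ->
  (exists M, forall n, (M <= n)%N -> N n -> (h n)%:R <= H) ->
  exists2 G : R, 0 < G & forall (m : nat -> nat) (A : R), 0 < A ->
  (exists M, forall n, (M <= n)%N -> N n -> (m n)%:R <= A * n%:R `^ (1 - 1 / L%:R)) ->
  exists M, forall n, (M <= n)%N -> N n -> expR (- (G * A ^+ L)) <= prF K p B h m sat n.
Proof.
move=> H0 [M1 hH]; exists (2 * (2 * H) ^+ L.-1); first by rewrite mulr_gt0 // exprn_gt0 // mulr_gt0.
move=> m A A0 [M2 Am].
have L0 : 0 < L%:R :> R by rewrite ltr0n expn_gt0.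
have [M3 H3] := @powR_eventually_ge R (1 / L%:R) (4 * A * H) (divr_gt0 ltr01 L0).
exists (maxn M1 (maxn M2 M3)) => n; rewrite !geq_max => /and3P[n1 n2 n3] Nn.
have k0 : (0 < k)%N by apply: (k_gt0 K_type K_k).
have kh : (k <= h n)%N by apply: (k_le_h (fun t => K_fits t Nn) K_k).
have h0 : (0 < h n)%N by apply: leq_trans kh.
have B0 : (0 < B n)%N by apply: (B_gt0 (fun t => K_fits t Nn) K_k).
have nBh : n%:R = (B n)%:R * (h n)%:R :> R by rewrite -natrM -N_split.
have BR : 0 < (B n)%:R :> R by rewrite ltr0n.
have hR : 0 < (h n)%:R :> R by rewrite ltr0n.
have nR : 0 < n%:R :> R by rewrite nBh mulr_gt0.
have nB : n%:R <= (B n)%:R * H by rewrite nBh ler_pM2l // hH.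
have pw : n%:R = n%:R `^ (1 - 1 / L%:R) * n%:R `^ (1 / L%:R) :> R.
  by rewrite -powRD ?subrK ?powRr1 ?(ltW nR) // gt_eqF ?implybT.
have pw' : n%:R ^+ L.-1 = (n%:R `^ (1 - 1 / L%:R)) ^+ L :> R.
  rewrite -[RHS]powR_mulrn ?powR_ge0 // -powRrM mulrBl divfK ?gt_eqF // mul1r.
  by rewrite -[X in _ - X]/(1%:R) -natrB ?expn_gt0 // subn1 powR_mulrn // ltW.
have w0 : 0 < n%:R `^ (1 - 1 / L%:R) :> R by apply: powR_gt0.
move: pw pw' w0 (Am n n2 Nn) (H3 n n3).
set w := n%:R `^ (1 - _); set v := n%:R `^ _ => pw pw' w0 mA vA.
(* The factor 4, rather than the 2 of [Pr_unif_sat_lower], gives [q <= 1/2], hence [y <= 1/2]. *)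
have m4 : 4 * (m n)%:R <= (B n)%:R :> R.
  rewrite -(ler_pM2r H0); apply: le_trans nB; rewrite pw.
  apply: (@le_trans _ _ (w * (4 * A * H))); last by rewrite ler_pM2l.
  have := ler_wpM2r (ltW H0) mA; lra.
have mB : (2 * m n <= B n)%N.
  by rewrite -(ler_nat R) natrM; apply: le_trans m4; rewrite ler_wpM2r // ler_nat.
have -> : prF K p B h m sat n = Pr (unif R (Omega n (B n) (h n) [:: k])) (@sat n (m n)).
  by rewrite /prF; congr Pr; apply/funext; apply: (mixture1 _ _ p_sum1 K_k T1).
apply: le_trans (@Pr_unif_sat_lower n (B n) (h n) k (m n) k0 kh B0 (N_split Nn) R mB).
set q := _ / _; set y := q ^+ _.
have q0 : 0 <= q by rewrite divr_ge0 // ltW.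
have q1 : q <= 2^-1 by rewrite /q ler_pdivrMr // ler_pdivlMl //; lra.
have L1 : (0 < L.-1)%N by rewrite -subn1 subn_gt0 -[X in (X < _)%N](expn0 2) ltn_exp2l.
have y0 : 0 <= y by apply: exprn_ge0.
have y1 : y <= 2^-1.
  apply: le_trans (q1); rewrite /y -[X in _ <= X]expr1; apply: ler_wiXn2l => //.
  by apply: le_trans q1 _; rewrite invf_le1 ?ler1n.
have my : (m n)%:R * y <= (2 * H) ^+ L.-1 * A ^+ L.
  rewrite /y /q expr_div_n exprMn mulrA ler_pdivrMr ?exprn_gt0 //.
  have -> : (m n)%:R * (2 ^+ L.-1 * (m n)%:R ^+ L.-1) = 2 ^+ L.-1 * (m n)%:R ^+ L :> R.
    by rewrite -[in RHS](prednK (_ : 0 < L)%N) ?expn_gt0 // exprS; ring.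
  have mL : (m n)%:R ^+ L <= A ^+ L * (H ^+ L.-1 * (B n)%:R ^+ L.-1).
    apply: (@le_trans _ _ ((A * w) ^+ L)).
      by rewrite lerXn2r ?nnegrE ?mulr_ge0 // ltW.
    rewrite exprMn ler_wpM2l ?exprn_ge0 ?(ltW A0) // -pw' -exprMn.
    by apply: lerXn2r; rewrite ?nnegrE ?(ltW nR) ?mulr_ge0 ?(ltW H0) ?(ltW BR) // mulrC.
  apply: le_trans (ler_wpM2l _ mL) _; first exact: exprn_ge0.
  by rewrite [in X in _ <= X]exprMn; lra.
apply: (@le_trans _ _ (expR (- (2 * y)) ^+ m n)).
  rewrite -expRM_natl ler_expR mulrN lerN2 mulrCA -mulrA ler_pM2l //.
by rewrite lerXn2r ?nnegrE ?expR_ge0 ?expR_le_1sub //; lra.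
Qed.

End AsymptoticsSat.

(** * Limits and Landau relations read as eventual inequalities *)

Lemma esup_lt1 (R : realType) (N : set nat) (f : nat -> R) (b : R) : b < 1 ->
  (exists M, forall n, (M <= n)%N -> N n -> f n <= b) ->
  (limf_esup (fun n => (f n)%:E) (within N \oo%classic) < 1%:E)%E.
Proof.
move=> b1 /alongP fb; rewrite limf_esupE; apply: (@le_lt_trans _ _ b%:E); last by rewrite lte_fin.
apply: le_trans (ereal_inf_lbound _) _; first by exists [set n | f n <= b]%classic; first exact: fb.
by apply: ub_ereal_sup => _ [n /= fn <-]; rewrite lee_fin.
Qed.

Lemma einf_gt0 (R : realType) (N : set nat) (f : nat -> R) (b : R) : 0 < b ->
  (exists M, forall n, (M <= n)%N -> N n -> b <= f n) ->
  (0%:E < limf_einf (fun n => (f n)%:E) (within N \oo%classic))%E.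
Proof.
move=> b0 /alongP fb; rewrite limf_einfE; apply: (@lt_le_trans _ _ b%:E); first by rewrite lte_fin.
apply: le_trans (ereal_sup_ubound _); last by exists [set n | b <= f n]%classic; first exact: fb.
by apply: le_ereal_inf_tmp => _ [n /= fn <-]; rewrite lee_fin.
Qed.

Lemma ln_eventually_ge (R : realType) (A : R) :
  exists M, forall n, (M <= n)%N -> A <= ln n%:R.
Proof.
exists (Num.truncn (expR A)).+1 => n Mn.
have An : expR A <= n%:R.
  by apply: ltW; apply: lt_le_trans (Num.Theory.truncnS_gt _) _; rewrite ler_nat.
by rewrite -[A]expRK ler_ln ?posrE ?expR_gt0 // (lt_le_trans (expR_gt0 A)).
Qed.

Local Open Scope classical_set_scope.
Local Open Scope ring_scope.

Lemma bigO_along (R : realType) (N : set nat) (f g : nat -> R) :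
  let F := within N \oo in f =O_F g ->
  exists2 C, 0 < C & exists M, forall n, (M <= n)%N -> N n -> `|f n| <= C * `|g n|.
Proof. by move=> F /eqO_exP[C C0 /alongP H]; exists C. Qed.

Lemma littleo_along (R : realType) (N : set nat) (f g : nat -> R) :
  let F := within N \oo in f =o_F g -> forall e, 0 < e ->
  exists M, forall n, (M <= n)%N -> N n -> `|f n| <= e * `|g n|.
Proof. by move=> F /eqoP H e /H /alongP. Qed.

Lemma bigOmega_along (R : realType) (N : set nat) (f g : nat -> R) :
  let F := within N \oo in f =Omega_F g ->
  exists2 c, 0 < c & exists M, forall n, (M <= n)%N -> N n -> c * `|g n| <= `|f n|.
Proof.
move=> F; rewrite eqOmegaE eqOmegaO => /bigO_along[C C0 [M H]]; exists C^-1; first by rewrite invr_gt0.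
by exists M => n Mn Nn; rewrite ler_pdivrMl // H.
Qed.

Lemma bigTheta_along (R : realType) (N : set nat) (f g : nat -> R) :
  let F := within N \oo in f =Theta_F g ->
  (exists2 c, 0 < c & exists M, forall n, (M <= n)%N -> N n -> c * `|g n| <= `|f n|) /\
  (exists2 C, 0 < C & exists M, forall n, (M <= n)%N -> N n -> `|f n| <= C * `|g n|).
Proof.
move=> F; rewrite eqThetaE bigThetaE -eqOmegaE => -[fO fOm].
by split; [exact: bigOmega_along | exact: bigO_along].
Qed.

Theorem theorem3p2 (R : realType)
  (T : nat) (K : 'I_T -> seq nat) (p : 'I_T -> R) (k : nat)
  (N : set nat) (B h : nat -> nat)
  (K_type : forall t, is_clause_type (K t)) (K_inj : injective K)
  (K_k : exists t, K t = [:: k])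
  (p_gt0 : forall t, 0 < p t) (p_sum1 : \sum_t p t = 1)
  (N_infinite : infinite_set N)
  (N_split : forall n, N n -> n = (B n * h n)%N)
  (K_fits : forall n t, N n -> fits (B n) (h n) (K t)) :
  let F := along N in
  [/\
    (* (a) *)
    natfun R h =O_F (fun=> 1 : R) ->
    forall m : nat -> nat,
    let thr := fun n : nat => n%:R `^ (1 - 1 / 2 ^+ k) : R in
    [/\ T = 1%N -> natfun R m =o_F thr ->
          prF K p B h m sat @ F --> (1 : R),
        natfun R m =Theta_F thr ->
          (limf_esup (fun n => (prF K p B h m sat n)%:E) F < 1%:E)%E /\
          (T = 1%N ->
            (0%:E < limf_einf (fun n => (prF K p B h m sat n)%:E) F)%E)
      & thr =o_F natfun R m ->
          prF K p B h m unsat @ F --> (1 : R)],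
    (* (b) *)
    natfun R h =o_F (fun n : nat => ln n%:R / ln (ln n%:R) : R) ->
    forall (m : nat -> nat) (theta c : R), 0 < theta -> 0 < c ->
    (\forall n \near F, c * (n%:R / ln n%:R `^ theta) <= (m n)%:R) ->
    prF K p B h m unsat @ F --> (1 : R),
    (* (c) *)
    (2 <= k)%N ->
    natfun R h =o_F (fun n : nat => ln n%:R : R) ->
    forall (m : nat -> nat) (beta : R), beta < 1 / rstar R k ->
    (* Without this lower bound on h the claim contradicts (a) when k = 2 and
       h is 2 or 3; it holds in particular whenever h tends to infinity. *)
    (\forall n \near F, beta * 2 ^+ k < (h n)%:R) ->
    natfun R m =Omega_F
      (fun n : nat => n%:R * expR (- (beta * ln n%:R / (h n)%:R)) : R) ->
    prF K p B h m unsat @ F --> (1 : R)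
    (* (d) *)
  & (2 <= k)%N ->
    natfun R h =O_F (fun n : nat => ln n%:R : R) ->
    T = 1%N ->
    exists2 eps0 : R, 0 < eps0 &
    forall (m : nat -> nat) (alpha : R), rstar R k - eps0 < alpha ->
    (* m(n) = alpha n, rounded either way. *)
    (forall n, N n -> `|(m n)%:R - alpha * n%:R| < 1) ->
    prF K p B h m unsat @ F --> (1 : R)].
Proof.
move: K_k => [t0 Kt0] F.
have L_eq : (2 ^ k)%:R = 2 ^+ k :> R by rewrite natrX.
have n_gt0 n : N n -> (0 < n)%N.
  move=> Nn; have fit t := K_fits n t Nn.
  by rewrite (N_split _ Nn) muln_gt0 (B_gt0 fit Kt0) (h_gt0 K_type fit Kt0).
have natfunE (f : nat -> nat) n : `|natfun R f n| = (f n)%:R by rewrite ger0_norm.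
have sat_ge0 m n : 0 <= prF K p B h m sat n by apply: prF_sat_ge0.
have sat_le1 m n : N n -> prF K p B h m sat n <= 1.
  by apply: (prF_sat_le1 K_type p_gt0 p_sum1 N_split K_fits Kt0).
have polylog := unsat_of_polylog K_type K_inj p_gt0 p_sum1 N_split K_fits Kt0.
have n_ge_powR n (a : R) : N n -> 0 <= a -> n%:R `^ (1 - a) <= n%:R :> R.
  move=> /n_gt0 n0 a0; rewrite -[X in _ <= X](@powRr1 R n%:R) //.
  by rewrite ler_powR ?ler1n // gerBl.
split.
- move=> /bigO_along[H H0 [MH hH]] m thr.
  have thr_ge0 n : `|thr n| = thr n by rewrite ger0_norm ?powR_ge0.
  have hH' : exists M, forall n, (M <= n)%N -> N n -> (h n)%:R <= H.
    by exists MH => n n1 Nn; have := hH n n1 Nn; rewrite natfunE normr1 mulr1.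
  have [c c0 upper] := sat_upper_bounded K_type K_inj p_gt0 p_sum1 N_split K_fits Kt0 H0 hH'.
  have thrE n : thr n = n%:R `^ (1 - 1 / (2 ^ k)%:R) by rewrite /thr L_eq.
  split.
  + move=> T1 /littleo_along mo; apply: along_cvg1 => e e0.
    have [G G0 lower] := sat_lower_bounded K_type p_sum1 N_split K_fits Kt0 T1 H0 hH'.
    (* With [A <= 1] one has [G * A ^+ L <= G * A <= e], so the lower bound is at least [1 - e]. *)
    pose A := Num.min 1 (e / G).
    have A0 : 0 < A by rewrite lt_min ltr01 divr_gt0.
    have A1 : A <= 1 by rewrite ge_min lexx.
    have [M2 Am] := mo A A0.
    have [|M HM] := lower m A A0.
      exists M2 => n n2 Nn; have := Am n n2 Nn.
      by rewrite natfunE thr_ge0 thrE.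
    exists M => n Mn Nn; rewrite sat_le1 // andbT; apply: le_trans (HM n Mn Nn).
    apply: le_trans (expR_ge1Dx _); rewrite lerD2l lerN2.
    have AL : A ^+ (2 ^ k) <= A.
      by rewrite -[X in _ <= X]expr1; apply: ler_wiXn2l; rewrite ?(ltW A0) ?expn_gt0.
    apply: le_trans (ler_wpM2l (ltW G0) AL) _.
    by rewrite mulrC -ler_pdivlMr // ge_min lexx orbT.
  + move=> /bigTheta_along[[c1 c10 [M1 lo]] [C C0 [M2 up]]]; split.
      apply: (@esup_lt1 _ _ _ (1 + c * c1 ^+ (2 ^ k))^-1).
        by rewrite invf_lt1 ?ltrDl ?ltr_wpDr ?ltW ?mulr_gt0 ?exprn_gt0.
      apply: upper => //; exists M1 => n n1 Nn; have := lo n n1 Nn.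
      by rewrite natfunE thr_ge0 thrE.
    move=> T1.
    have [G G0 lower] := sat_lower_bounded K_type p_sum1 N_split K_fits Kt0 T1 H0 hH'.
    apply: (@einf_gt0 _ _ _ (expR (- (G * C ^+ (2 ^ k))))); first exact: expR_gt0.
    apply: lower => //; exists M2 => n n2 Nn; have := up n n2 Nn.
    by rewrite natfunE thr_ge0 thrE.
  + move=> /littleo_along mo.
    apply: along_cvg1 => e e0.
    have ei : 0 < e^-1 by rewrite invr_gt0.
    (* With [A >= 1] one has [c * A ^+ L >= c * A >= e^-1], so the upper bound is at most [e]. *)
    pose A := Num.max 1 (e^-1 / c).
    have A1 : 1 <= A by rewrite le_max lexx.
    have A0 : 0 < A by apply: lt_le_trans A1.
    have [M1 lo] : exists M, forall n, (M <= n)%N -> N n -> `|thr n| <= A^-1 * `|natfun R m n|.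
      by apply: mo; rewrite invr_gt0.
    have [|M HM] := upper m A A0.
      exists M1 => n n1 Nn; have := lo n n1 Nn.
      by rewrite natfunE thr_ge0 thrE ler_pdivlMl.
    exists M => n Mn Nn; rewrite (prF_unsat K_type p_sum1 N_split K_fits Kt0) //.
    rewrite gerBl sat_ge0 andbT lerD2l lerN2; apply: le_trans (HM n Mn Nn) _.
    have cA : e^-1 <= c * A ^+ (2 ^ k).
      rewrite -ler_pdivrMl // mulrC; apply: (@le_trans _ _ A); first by rewrite le_max lexx orbT.
      by rewrite -[X in X <= _]expr1; apply: ler_weXn2l; rewrite ?expn_gt0.
    by rewrite -[e]invrK lef_pV2 ?posrE //; lra.
(* (b): [h <= ln n] once [ln (ln n) >= 1], and [ln n] to the power [theta] is at most
   [D * n^(1/(2L))]; so [polylog] applies with [d = 1/2]. *)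
- move=> /littleo_along ho m theta c theta0 c0 /alongP[M1 mc].
  have [M2 hM] := ho 1 ltr01.
  have [M3 H3] := ln_eventually_ge (expR 1 : R).
  pose j := (Num.truncn theta).+1.
  have s0 : 0 < 2^-1 / (2 ^ k)%:R :> R by rewrite divr_gt0 // ltr0n expn_gt0.
  have [D D0 DH] := ln_exp_le_powR j s0.
  apply: (polylog 1 (c / D) 2^-1 m ltr01); rewrite ?divr_gt0 //.
  + by lra.
  + exists (maxn M2 M3) => n; rewrite geq_max => /andP[n2 n3] Nn; rewrite mul1r.
    have := hM n n2 Nn; rewrite natfunE mul1r => /le_trans; apply.
    have e1 : 1 <= expR 1 :> R by apply: (expR_nat_ge1 R 1).
    have ln1 : expR 1 <= ln n%:R :> R by apply: H3.
    have ln0 : 0 < ln n%:R :> R by apply: lt_le_trans ln1; apply: expR_gt0.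
    have lnln : 1 <= ln (ln n%:R) :> R by rewrite -[X in X <= _]expRK ler_ln ?posrE ?expR_gt0.
    have lnln0 : 0 < ln (ln n%:R) :> R by apply: lt_le_trans lnln.
    rewrite ger0_norm; last by rewrite divr_ge0 // ltW.
    by rewrite ler_pdivrMr // ler_peMr // ltW.
  + exists (maxn M1 M3) => n; rewrite geq_max => /andP[n1 n3] Nn.
    apply: le_trans (mc n n1 Nn).
    have nR : 0 < n%:R :> R by rewrite ltr0n n_gt0.
    have ln1 : 1 <= ln n%:R :> R.
      by apply: le_trans (H3 n n3); apply: (expR_nat_ge1 R 1).
    have lnp : ln n%:R `^ theta <= D * n%:R `^ (2^-1 / (2 ^ k)%:R).
      apply: le_trans (DH n (n_gt0 n Nn)); rewrite -powR_mulrn ?(le_trans _ ln1) //.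
      by rewrite ler_powR // ltW // Num.Theory.truncnS_gt.
    have lnp0 : 0 < ln n%:R `^ theta by rewrite powR_gt0 // (lt_le_trans _ ln1).
    have w0 : 0 < n%:R `^ (2^-1 / (2 ^ k)%:R) :> R by rewrite powR_gt0.
    have -> : 1 - (1 - 2^-1) / (2 ^ k)%:R = 1 - 2^-1 / (2 ^ k)%:R :> R.
      by congr (_ - _ / _); lra.
    have wE : n%:R = n%:R `^ (1 - 2^-1 / (2 ^ k)%:R) * n%:R `^ (2^-1 / (2 ^ k)%:R) :> R.
      by rewrite -powRD ?subrK ?powRr1 ?(ltW nR) // (gt_eqF nR) implybT.
    have cDw : 0 <= c / D * n%:R `^ (1 - 2^-1 / (2 ^ k)%:R).
      by rewrite mulr_ge0 ?powR_ge0 // ltW // divr_gt0.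
    rewrite mulrA ler_pdivlMr //; apply: le_trans (ler_wpM2l cDw lnp) _.
    rewrite [in X in _ <= X]wE le_eqVlt; apply/orP; left; apply/eqP; field.
    by rewrite gt_eqF.
(* (c): the lower bound on [m] is [c * n^(1 - beta/h)], so [polylog] needs [beta/h <= (1 - d)/L]
   with one [d > 0] for all large [n]. *)
- move=> k2 /littleo_along ho m beta _ /alongP[M1 bh] /bigOmega_along[c c0 [M2 mc]].
  have [M3 hM] := ho 1 ltr01.
  have L0 : 0 < (2 ^ k)%:R :> R by rewrite ltr0n expn_gt0.
  have hln : exists M, forall n, (M <= n)%N -> N n -> (h n)%:R <= 1 * ln n%:R :> R.
    exists M3 => n n3 Nn; have := hM n n3 Nn.
    by rewrite natfunE ger0_norm // ln_ge0 // ler1n n_gt0.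
  (* As h is an integer, beta 2^k < h leaves a positive gap. *)
  have [d [d0 d1 dH]] : exists d : R, [/\ 0 < d, d <= 1 &
      forall n, (M1 <= n)%N -> N n -> beta / (h n)%:R <= (1 - d) / (2 ^ k)%:R].
    have h0 n : N n -> 0 < (h n)%:R :> R.
      by move=> Nn; rewrite ltr0n (h_gt0 K_type (fun t => K_fits n t Nn) Kt0).
    have [b0|b0] := leP beta 0.
      exists 1; split=> // n _ Nn; rewrite subrr mul0r.
      by rewrite ler_pdivrMr ?h0 // mul0r.
    have bL : 0 < beta * 2 ^+ k by rewrite mulr_gt0 // exprn_gt0.
    (* [h1] is the least integer above [beta * 2 ^+ k], hence [h1 <= h n]; [d] is the gap at
       [h1]. *)
    pose h1 := (Num.truncn (beta * 2 ^+ k)).+1.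
    have h1R : 0 < h1%:R :> R by rewrite ltr0n.
    have bh1 : beta * 2 ^+ k < h1%:R by apply: Num.Theory.truncnS_gt.
    exists (1 - beta * 2 ^+ k / h1%:R); split.
    - by rewrite subr_gt0 ltr_pdivrMr // mul1r.
    - by rewrite gerBl divr_ge0 // ltW.
    move=> n n1 Nn; rewrite subKr -L_eq.
    have -> : beta * (2 ^ k)%:R / h1%:R / (2 ^ k)%:R = beta / h1%:R.
      by field; rewrite !gt_eqF.
    rewrite ler_pM2l // lef_pV2 ?posrE ?h0 // ler_nat.
    have := bh n n1 Nn; rewrite ltNge; apply: contraNT; rewrite -ltnNge ltnS => hh.
    by apply: le_trans (_ : (Num.truncn (beta * 2 ^+ k))%:R <= _);
      rewrite ?ler_nat // Num.Theory.truncn_le ltW.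
  apply: (polylog 1 c d m ltr01 c0 d0 d1 hln).
  exists (maxn M1 M2) => n; rewrite geq_max => /andP[n1 n2] Nn.
  have nR : 0 < n%:R :> R by rewrite ltr0n n_gt0.
  have := mc n n2 Nn; rewrite natfunE; apply: le_trans; rewrite ler_pM2l //.
  rewrite ger0_norm ?mulr_ge0 ?expR_ge0 //.
  have -> : expR (- (beta * ln n%:R / (h n)%:R)) = n%:R `^ (- (beta / (h n)%:R)).
    by rewrite /powR gt_eqF //; congr expR; rewrite mulNr mulrAC.
  have -> : n%:R * n%:R `^ (- (beta / (h n)%:R)) = n%:R `^ (1 - beta / (h n)%:R).
    by rewrite powRD ?powRr1 ?(ltW nR) // (gt_eqF nR) implybT.
  by rewrite ler_powR ?ler1n ?n_gt0 // lerD2l lerN2 dH.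
- move=> k2 /bigO_along[C C0 [M1 hC]] _.
  (* (d): with [eps0 = rstar R k] the condition on [alpha] becomes [0 < alpha], and a linear number
     of clauses exceeds what [polylog] needs for [d = 1/2]. *)
  have r0 := rstar_gt0 R k2; exists (rstar R k) => // m alpha; rewrite subrr => a0 ma.
  apply: (polylog C (alpha / 2) 2^-1 m C0); rewrite ?divr_gt0 //.
  + by lra.
  + exists M1 => n n1 Nn; have := hC n n1 Nn.
    by rewrite natfunE ger0_norm // ln_ge0 // ler1n n_gt0.
  (* For [n >= 2 / alpha], half of [alpha * n] is at least 1 and absorbs the rounding of [m n]. *)
  + have [M2 H2] := powR_eventually_ge (2 / alpha) (ltr01 : 0 < 1 :> R).
    exists M2 => n n2 Nn; have := H2 n n2; rewrite powRr1 // ler_pdivrMr // => n2a.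
    have s0 : 0 <= (1 - 2^-1) / (2 ^ k)%:R :> R by rewrite divr_ge0 //; lra.
    apply: le_trans (ler_wpM2l _ (n_ge_powR n _ Nn s0)) _; first by rewrite ltW // divr_gt0.
    by have := ma n Nn; rewrite ltr_norml => /andP[]; lra.
Qed.
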